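(* There exists a constant $C_0>0$, independent of $N$ and of the choice of the permutation matrices $U_1,\dots,U_d$, such that for all $N\ge 1$ and all $r>0$, $$\#\{ j\in \mathbb{N} : |\lambda_j(\mathscr{L}_N)| \geq r^{-1}\}\leq C_0\, r N.$$
   Context: Let $\Omega_0\subset\mathbb{C}$ be a bounded, simply connected open set with boundary at least $C^2$ regular. Let $d\ge 2$ and let $\gamma_1,\dots,\gamma_d:\Omega_0\to\Omega_0$ be holomorphic maps, each extending continuously to $\overline{\Omega_0}$ and satisfying $\overline{\gamma_j(\Omega_0)}\subset\Omega_0$. Let $G:\Omega_0\to\mathbb{C}$ be holomorphic on $\Omega_0$ and extend continuously to $\overline{\Omega_0}$. For $N\ge1$ let $U_1,\dots,U_d$ be $N\times N$ permutation matrices. The space $\mathcal{H}_N=H^2(\Omega_0,\mathbb{C}^N)$ is the Bergman space of holomorphic $F:\Omega_0\to\mathbb{C}^N$ with $\int_{\Omega_0}\|F(z)\|^2dm(z)<\infty$ ($m$ is Lebesgue measure on $\mathbb{C}$, $\|\cdot\|$ the Hermitian norm on $\mathbb{C}^N$). The twisted transfer operator $\mathscr{L}_N:\mathcal{H}_N\to\mathcal{H}_N$ is $$\mathscr{L}_N(F)(z)=\sum_{j=1}^d e^{G(\gamma_j z)}U_jF(\gamma_j z).$$ It is compact and trace class; $(\lambda_j(\mathscr{L}_N))_{j\in\mathbb{N}}$ denotes its sequence of eigenvalues, counted with algebraic multiplicity, with $\lambda_j(\mathscr{L}_N)\to0$. *)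

(* Defs.v *)
From mathcomp Require Import all_boot all_order all_algebra.
From mathcomp Require Import complex.
From mathcomp Require Import all_classical all_reals all_analysis.

Set Implicit Arguments.
Unset Strict Implicit.
Unset Printing Implicit Defensive.

Import Order.TTheory GRing.Theory Num.Theory.
Import numFieldNormedType.Exports. Import Normc.

Local Open Scope classical_set_scope.
Local Open Scope complex_scope.
Local Open Scope ring_scope.

(* The bare names would resolve to the partial projections of Num. *)
Local Notation Re := complex.Re.
Local Notation Im := complex.Im.

(* The alias [^o] is what gives R[i] its topology (that of the modulus) and its
   structure of normed space over itself. *)
Notation CC R := (R[i]^o).

Section ComplexPlane.
Context {R : realType}.
Implicit Types (A : set (CC R)) (f : CC R -> CC R).

Definition cexp (z : R[i]) : R[i] :=
  (expR (Re z))%:C * (cos (Im z) +i* sin (Im z)).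

Definition holomorphic_on A f := forall z, A z -> derivable f z 1.

Definition extends_continuously A f :=
  exists g : CC R -> CC R, {within closure A, continuous g} /\ {in A, g =1 f}.

Definition path_connected A := forall x y, A x -> A y ->
  exists c : R -> CC R, [/\ {within `[0, 1], continuous c},
    c @` `[0, 1] `<=` A, c 0 = x & c 1 = y].

(* Every loop in A is homotopic to a constant, relative to its base point. *)
Definition simply_connected A := path_connected A /\
  forall c : R -> CC R, {within `[0, 1], continuous c} ->
    c @` `[0, 1] `<=` A -> c 0 = c 1 ->
  exists h : R * R -> CC R, [/\ {within `[0, 1] `*` `[0, 1], continuous h},
    h @` (`[0, 1] `*` `[0, 1]) `<=` A,
    forall s, 0 <= s <= 1 -> h (s, 0) = c s /\ h (s, 1) = c 0 &
    forall t, 0 <= t <= 1 -> h (0, t) = c 0 /\ h (1, t) = c 0].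

Definition C2 (phi : R -> R) :=
  [/\ forall x, derivable phi x 1, forall x, derivable (derive1 phi) x 1 &
      continuous (derive1 (derive1 phi))].

(* Near each boundary point p, after a rigid motion z |-> u (z - p), A is the
   region lying strictly above the graph of a C^2 function. *)
Definition C2_boundary A := forall p, (closure A `\` A°) p ->
  exists (e : R) (u : R[i]) (phi : R -> R),
    [/\ 0 < e, normc u = 1, C2 phi &
      forall z, normc (z - p) < e ->
        A z <-> phi (Re (u * (z - p))) < Im (u * (z - p))].

End ComplexPlane.

Section Spectrum.
Context {K : numFieldType} {V : lmodType K}.
Implicit Types (W H : set V) (L : V -> V).

Definition has_dimension W (n : nat) := exists b : 'I_n -> V,
  (forall a : 'I_n -> K, \sum_i a i *: b i = 0 -> forall i, a i = 0) /\
  (forall v, W v <-> exists a : 'I_n -> K, v = \sum_i a i *: b i).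

(* Generalized eigenspace of L acting on the subspace H of V. *)
Definition gen_eigenspace H L (mu : K) : set V :=
  [set v | H v /\ exists k, iter k (fun w => L w - mu *: w) v = 0].

(* lam lists the nonzero eigenvalues of L on H with algebraic multiplicity, and
   tends to 0.  Zero terms are unconstrained, so that the list may be padded
   with 0 when L has only finitely many nonzero eigenvalues. *)
Definition eigenvalue_sequence H L (lam : nat -> K^o) :=
  lam @ \oo --> (0 : K^o) /\
  forall mu : K, mu != 0 -> exists n,
    has_dimension (gen_eigenspace H L mu) n /\ ([set j | lam j = mu] #= `I_n)%card.

End Spectrum.

Section TransferOperator.
Context {R : realType}.
Implicit Types (Omega : set (CC R)) (N : nat).

(* A function on Omega is represented by its extension by 0 to the whole plane,
   so that equality of functions on Omega is plain equality. *)
Definition bergman Omega N : set (CC R -> 'cV[R[i]]_N) := [set F |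
  [/\ forall z, ~ Omega z -> F z = 0,
      forall i, holomorphic_on Omega (fun z => F z i ord0) &
      (\int[lebesgue_measure \x lebesgue_measure]_(p in
          [set p : R * R | Omega (p.1 +i* p.2)])
         (\sum_i normc (F (p.1 +i* p.2) i ord0) ^+ 2)%:E < +oo)%E]].

Definition transfer Omega N d (gam : 'I_d -> CC R -> CC R) (G : CC R -> CC R)
    (U : 'I_d -> 'M[R[i]]_N) (F : CC R -> 'cV[R[i]]_N) : CC R -> 'cV[R[i]]_N :=
  fun z => if z \in Omega
           then \sum_j cexp (G (gam j z)) *: (U j *m F (gam j z)) else 0.

End TransferOperator.

(* Main.v *)
Require Import Defs.
From mathcomp Require Import finmap.
From mathcomp Require Import all_boot all_order all_algebra.
From mathcomp Require Import complex.
From mathcomp Require Import all_classical all_reals all_analysis.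
From mathcomp Require Import perm spectral sesquilinear mxred.
From mathcomp Require Import ring lra.
Import Order.TTheory GRing.Theory Num.Theory.
Import numFieldNormedType.Exports. Import Normc.
Local Open Scope classical_set_scope.
Local Open Scope complex_scope.
Local Open Scope ring_scope.
Set Implicit Arguments.
Unset Strict Implicit.
Unset Printing Implicit Defensive.

(** The idea is that the eigenvalues of the transfer operator L have absolute
    values whose sum is at most C N: if n of them are at least 1/r, then
    n/r <= C N.  The sum is bounded by writing L as a product of two
    Hilbert-Schmidt operators, each of squared Hilbert-Schmidt norm O(N).

    Let K be the union of the closures of the sets gam_j(Omega), a compact subset
    of Omega.  The values of L F on Omega depend on F only through its values
    on K.  Cover K by finitely many squares c + rho [-1,1]^2 such that the
    squares c + rho [-4,4]^2 still lie in Omega ([bounding_squares]), and let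
    the inner (outer) norm of F be the L^2 norm of F over the boundaries of
    the squares c + rho [-2,2]^2 (of c + rho [-4,4]^2).  A holomorphic function
    is controlled on a square of half-side rho by its L^2 norm on the boundary
    of the square of half-side 2 rho ([submean_le]).  So evaluation at a point
    of K is bounded for the inner norm, and evaluation at a point of an inner
    boundary is bounded for the outer norm.  Such a bound on evaluations says
    that, for every orthonormal family e_i and every coordinate a, the sum of
    the |e_i(x)_a|^2 is at most a constant kappa ([orthonormal_evaluation]).
    Summing over the N coordinates and integrating over the boundaries bounds
    by O(N) the squared Hilbert-Schmidt norms both of the identity from the
    outer to the inner norm, and of L from the inner to the outer norm.  The
    matrices U_j enter only as permutations of the coordinates, which leaves
    the bound independent of them.

    All of this is applied on a finite-dimensional space W invariant under L,
    the sum of the generalized eigenspaces for the eigenvalues of modulus at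
    least 1/r.  Its dimension is the number n of terms to be counted
    ([spectral_count]).  In a basis of W that is orthonormal for the outer norm
    and triangularizes L (Schur), the diagonal entries are eigenvalues, and the
    Cauchy-Schwarz inequality, in the form 2xy <= x^2 + y^2, compares the sum of
    their moduli with the two Hilbert-Schmidt norms ([eigenvalue_count_le]).

    A function is holomorphic here when it is complex differentiable at every
    point of an open set, so the control on squares rests on Goursat's theorem
    ([goursat]): Cauchy's formula for a rectangle ([rect_cauchy]) follows by
    shrinking the rectangle around the singular point, and the integral of
    1/(z - x) over the boundary of a square need only be bounded from below
    ([square_winding_bound]). *)

Local Open Scope sesquilinear_scope.
Local Notation Re := complex.Re.
Local Notation Im := complex.Im.

(** * Eigenvalues of a matrix against two Hermitian forms *)

Section TwoForms.
Context {C : numClosedFieldType}.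

Definition posdefmx n (M : 'M[C]_n) :=
  M^t* = M /\ forall u : 'rV_n, u != 0 -> 0 < (u *m M *m u^t*) 0 0.

(** Diagonalize the form by a unitary matrix and divide each row by the square
    root of its (positive) eigenvalue. *)
Lemma orthonormalizing_mx n (M : 'M[C]_n) : posdefmx M ->
  exists2 S : 'M[C]_n, S \in unitmx & S *m M *m S^t* = 1%:M.
Proof.
move=> [Mh Mpos].
have Mn : M \is normalmx by apply/normalmxP; rewrite Mh.
have Pu := spectral_unitarymx M.
have [/= PV Pi] := (unitarymx_unit Pu, invmx_unitary Pu).
move/orthomx_spectralP : Mn; rewrite Pi.
set P := spectralmx M in Pu PV Pi *; set D := spectral_diag M => ME.
have PMP : P *m M *m P^t* = diag_mx D.
  by rewrite ME !mulmxA mulmxtVK// (unitarymxP Pu) mul1mx.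
have Dpos i : 0 < D 0 i.
  have -> : D 0 i = (row i P *m M *m (row i P)^t*) 0 0.
    transitivity ((P *m M *m P^t*) i i); first by rewrite PMP !mxE eqxx.
    rewrite -row_mul !mxE; apply: eq_bigr => k _.
    by rewrite !mxE.
  apply: Mpos; apply/eqP => r0.
  move/row_unitarymxP: Pu => /(_ i i); rewrite r0 dotmxE eqxx mul0mx mxE.
  by move/eqP; rewrite eq_sym oner_eq0.
pose E : 'rV_n := \row_i (sqrtC (D 0 i))^-1.
have E0 i : 0 < E 0 i by rewrite mxE invr_gt0 sqrtC_gt0.
have Eu : diag_mx E \in unitmx.
  rewrite unitmxE det_diag unitfE; apply/prodf_neq0 => i _.
  by rewrite lt0r_neq0.
exists (diag_mx E *m P); first by rewrite unitmx_mul Eu.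
rewrite trmx_mul map_mxM !mulmxA.
rewrite -(mulmxA _ P M) -(mulmxA _ (P *m M)) PMP tr_diag_mx map_diag_mx.
apply/matrixP => i j; rewrite -mulmxA mul_diag_mx mul_mx_diag !mxE.
case: eqP => [->|]; last by rewrite !mulr0n mul0r mulr0.
rewrite !mulr1n -[X in _ * (X * _)](sqrtCK (D 0 j)).
have /CrealP E1 : (sqrtC (D 0 j))^-1 \is Num.real.
  by apply/ger0_real; rewrite invr_ge0 sqrtC_ge0 ltW.
rewrite [X in _ * (_ * X)]E1 expr2 mulfK ?mulVf//.
all: by rewrite sqrtC_eq0 lt0r_neq0.
Qed.

Lemma mxtrace_mul_tr m n (A : 'M[C]_(m, n)) :
  \tr (A *m A^t*) = \sum_i \sum_j `|A i j| ^+ 2.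
Proof.
apply: eq_bigr => i _; rewrite !mxE; apply: eq_bigr => j _.
by rewrite !mxE normCK.
Qed.

(** The rows of S are the coordinates of a basis; it is orthonormal for P when
    [S *m P *m S^t* = 1].  Then alpha bounds the squared Hilbert-Schmidt norm of the
    identity from the form P to the form M, and beta that of the operator A from
    M to P.  The trace norm of A, which dominates the sum of the moduli of its
    eigenvalues, is at most half the sum of the two. *)
Lemma eigenvalue_count_le n (A P M : 'M[C]_n) (delta alpha beta : C) :
  posdefmx P -> posdefmx M ->
  (forall a, eigenvalue A a -> delta <= `|a|) ->
  (forall S : 'M[C]_n, S *m P *m S^t* = 1%:M -> \tr (S *m M *m S^t*) <= alpha) ->
  (forall S : 'M[C]_n, S *m M *m S^t* = 1%:M ->
     \tr (S *m A *m P *m (S *m A)^t*) <= beta) ->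
  delta * n%:R *+ 2 <= alpha + beta.
Proof.
case: n A P M => [|n] A P M Pp Mp Adelta Halpha Hbeta.
  rewrite mulr0 mul0rn.
  have E0 (X : 'M[C]_0) : X = 1%:M by rewrite [LHS]flatmx0 [RHS]flatmx0.
  have := lerD (Halpha 0 (E0 _)) (Hbeta 0 (E0 _)).
  by rewrite !mul0mx mxtrace0 addr0.
have [S1 S1u S1P] := orthonormalizing_mx Pp.
have [T Tu] := @Schur _ _ (S1 *m A *m invmx S1) isT.
rewrite /similar_to /= conjymx// => Ttrig.
pose S := T *m S1.
have TU := unitarymx_unit Tu.
have SU : S \in unitmx by rewrite unitmx_mul TU.
have SP : S *m P *m S^t* = 1%:M.
  rewrite trmx_mul map_mxM !mulmxA -(mulmxA T) -(mulmxA T) S1P mulmx1.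
  exact/unitarymxP.
have SVE : invmx S = P *m S^t*.
  by rewrite -[RHS](mulKmx SU) (mulmxA S) SP mulmx1.
pose B := S *m A *m invmx S.
have Btrig : is_trig_mx B.
  rewrite (_ : B = T *m (S1 *m A *m invmx S1) *m T^t*)//.
  rewrite -[RHS](mulmxK SU); congr (_ *m _).
  by rewrite /S !mulmxA mulmxKtV// mulmxKV.
(* S is orthonormal for P and makes A triangular, Rr is orthonormal for M; with
   S = D Rr the triangular matrix B factors as D Z, where D and Z represent
   the identity and A between the two orthonormal bases. *)
clearbody S.
have [Rr RrU RM] := orthonormalizing_mx Mp.
pose D := S *m invmx Rr; pose Z := Rr *m A *m P *m S^t*.
have SE : S = D *m Rr by rewrite mulmxKV.
have BE : B = D *m Z.
  by rewrite /B SVE {1}SE /Z !mulmxA.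
have DD : \tr (D *m D^t*) <= alpha.
  rewrite (_ : D *m D^t* = S *m M *m S^t*); first exact: Halpha.
  rewrite [in RHS]SE (trmx_mul D Rr) map_mxM !mulmxA.
  by rewrite -(mulmxA D) -(mulmxA D) RM mulmx1.
have ZZ : \tr (Z *m Z^t*) <= beta.
  rewrite (_ : Z *m Z^t* = Rr *m A *m P *m (Rr *m A)^t*); first exact: Hbeta.
  rewrite /Z (trmx_mul _ (S^t*)) map_mxM trmxCK (trmx_mul _ P) map_mxM.
  rewrite Pp.1 !mulmxA; congr (_ *m _); rewrite -!mulmxA; congr (_ *m (_ *m _)).
  by rewrite (mulmxA P) -SVE mulKmx.
have Bdiag i : delta <= `|B i i|.
  apply: Adelta.
  have /eigenvalueP[v vB v0] : eigenvalue B (B i i).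
    rewrite eigenvalue_root_char char_poly_trig//.
    by rewrite /root (bigD1 i)//= hornerM hornerXsubC subrr mul0r.
  apply/eigenvalueP; exists (v *m S); last first.
    by apply: contraNneq v0 => vS; rewrite -(mulmxK SU v) vS mul0mx.
  by rewrite scalemxAl -vB /B !mulmxA mulmxKV.
rewrite mulr_natr -[n.+1]card_ord -sumr_const -sumrMnl.
apply: le_trans (lerD DD ZZ); rewrite !mxtrace_mul_tr.
rewrite [X in _ + X]exchange_big -big_split /=.
apply: ler_sum => i _; apply: le_trans (ler_wMn2r 2 (Bdiag i)) _.
rewrite BE mxE -big_split /=.
apply: le_trans (ler_wMn2r 2 (ler_norm_sum _ _ _)) _.
rewrite -sumrMnl; apply: ler_sum => j _.
(* 2 |D_ij| |Z_ji| <= |D_ij|^2 + |Z_ji|^2 *)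
have /real_exprn_even_ge0 : `|D i j| - `|Z j i| \is Num.real.
  by rewrite realB// normr_real.
by move=> /(_ 2%N isT); rewrite normrM sqrrB addrAC subr_ge0.
Qed.

End TwoForms.

(** * Complex numbers and complex differentiability *)

Section Complex.
Context {R : realType}.
Implicit Types (z w : CC R) (f g : CC R -> CC R).

Lemma normc_normE (z : R[i]) : `|z| = (normc z)%:C.
Proof. by []. Qed.

Lemma normc_ge0 (z : R[i]) : 0 <= normc z.
Proof. by case: z => a b; exact: sqrtr_ge0. Qed.

Lemma normc_dist (z w : R[i]) : normc (z - w) = normc (w - z).
Proof. by apply: complexI; rewrite -!normc_normE distrC. Qed.

Lemma normc_real (x : R) : normc x%:C = `|x|.
Proof. by rewrite /= expr0n addr0 sqrtr_sqr. Qed.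

Lemma normRe (z : R[i]) : `|Re z| <= normc z.
Proof.
case: z => a b /=; rewrite -sqrtr_sqr ler_wsqrtr// lerDl; exact: sqr_ge0.
Qed.

Lemma normIm (z : R[i]) : `|Im z| <= normc z.
Proof.
case: z => a b /=; rewrite -sqrtr_sqr ler_wsqrtr// lerDr; exact: sqr_ge0.
Qed.

Lemma normReB (z w : R[i]) : `|Re z - Re w| <= normc (z - w).
Proof. by case: z w => [a b] [c d]; exact: (normRe ((a +i* b) - (c +i* d))). Qed.

Lemma normImB (z w : R[i]) : `|Im z - Im w| <= normc (z - w).
Proof. by case: z w => [a b] [c d]; exact: (normIm ((a +i* b) - (c +i* d))). Qed.

Lemma normc_leD (z : R[i]) : normc z <= `|Re z| + `|Im z|.
Proof.
rewrite [z in leLHS]complexE; apply: le_trans (le_normcD _ _) _.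
by rewrite normcM !normc_real /= expr0n expr1n add0r sqrtr1 mul1r.
Qed.

Lemma normc_sqr (z : R[i]) : normc z ^+ 2 = Re z ^+ 2 + Im z ^+ 2.
Proof. by case: z => a b /=; rewrite sqr_sqrtr// addr_ge0// sqr_ge0. Qed.

Lemma normc_gt0 (z : R[i]) : z != 0 -> 0 < normc z.
Proof.
move=> z0; rewrite lt_neqAle normc_ge0 andbT eq_sym.
by apply: contra z0 => /eqP/eq0_normc ->.
Qed.

(** The norm of R[i] takes its values in R[i]; radii are brought back to R. *)
Lemma nbhsCP z (A : set (CC R)) :
  nbhs z A <-> exists2 e : R, 0 < e & forall w, normc (w - z) < e -> A w.
Proof.
rewrite nbhs_ballP; split=> [[[e e'] /= e0 eA]|[e e0 eA]].
  move: e0; rewrite ltcE /= => /andP[/eqP e'0 e0]; exists e => // w we.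
  apply: eA; rewrite -ball_normE /ball_ /=.
  by rewrite normc_normE normc_dist ltcE /= e'0 eqxx.
exists e%:C; first by rewrite /= ltcR.
by move=> w; rewrite -ball_normE /ball_ /= normc_normE ltcR normc_dist => /eA.
Qed.

(* Continuity, over any source, tested on moduli. *)
Lemma cvgCP (T : Type) (F : set_system T) (FF : Filter F) (f : T -> CC R) (l : CC R) :
  f @ F --> l <-> forall e : R, 0 < e -> \forall t \near F, normc (f t - l) < e.
Proof.
split=> [fl e e0|H].
  apply: (fl [set w | normc (w - l) < e]); apply/nbhsCP; exists e => //.
by move=> A /nbhsCP[e e0 eA]; apply: filterS (H e e0) => t; exact: eA.
Qed.

Lemma continuous_Re : continuous (@complex.Re R : CC R -> R).
Proof.
move=> z A /nbhs_ballP[e e0 eA]; apply/nbhsCP; exists e => // w wz.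
by apply: eA; rewrite -ball_normE /ball_ /= distrC; apply: le_lt_trans wz; exact: normReB.
Qed.

Lemma continuous_Im : continuous (@complex.Im R : CC R -> R).
Proof.
move=> z A /nbhs_ballP[e e0 eA]; apply/nbhsCP; exists e => // w wz.
by apply: eA; rewrite -ball_normE /ball_ /= distrC; apply: le_lt_trans wz; exact: normImB.
Qed.

Lemma continuous_normc : continuous (@normc R : CC R -> R).
Proof.
move=> z A /nbhs_ballP[e e0 eA]; apply/nbhsCP; exists e => // w wz.
apply: eA; rewrite -ball_normE /ball_ /=; apply: le_lt_trans wz; rewrite normc_dist ler_norml.
have := le_normcD (z - w) w; have := le_normcD (w - z) z.
by rewrite !subrK (normc_dist w z); lra.
Qed.

Lemma continuousC2 (T : topologicalType) (t : T) (u v : T -> R) :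
  {for t, continuous u} -> {for t, continuous v} ->
  {for t, continuous (fun x => u x +i* v x : CC R)}.
Proof.
move=> /cvgrPdist_lt cu /cvgrPdist_lt cv; apply/cvgCP => e e0.
have e2 : 0 < e / 2 by rewrite divr_gt0.
near=> x; apply: le_lt_trans (normc_leD _) _ => /=.
rewrite (splitr e) ltrD// distrC; near: x; [exact: cu|exact: cv].
Unshelve. all: by end_near. Qed.

Lemma derivable_continuousC f z : derivable f z 1 -> {for z, continuous f}.
Proof. by move/derivable1_diffP/differentiable_continuous. Qed.

(** First-order expansion at z, with error terms measured by real moduli. *)
Lemma derivable_expansion f z : derivable f z 1 ->
  exists l : CC R, forall e : R, 0 < e -> exists2 d : R, 0 < d &
    forall w, normc (w - z) < d ->
      normc (f w - f z - l * (w - z)) <= e * normc (w - z).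
Proof.
move=> /cvg_ex[/= l /cvgCP fl]; exists l => e /fl.
move=> /nbhsCP[d d0 H]; exists d => // w wz.
have [->|wz0] := eqVneq w z.
  by rewrite !subrr mulr0 subr0 normc0 mulr0.
have wz0' : w - z != 0 by rewrite subr_eq0.
have := H (w - z); rewrite subr0 => /(_ wz wz0').
rewrite (_ : (w - z)%:A + z = w); last by rewrite [X in X + z]mulr1 subrK.
move=> /ltW; rewrite -(ler_pM2r (normc_gt0 wz0')) -normcM mulrBl.
rewrite (_ : (w - z)^-1 *: (f w - f z) * (w - z) = f w - f z)//.
by rewrite [X in X * _]mulrC mulfVK.
Qed.

Lemma expansion_derivable f z (l : CC R) :
  (forall e : R, 0 < e -> exists2 d : R, 0 < d &
    forall w, normc (w - z) < d ->
      normc (f w - f z - l * (w - z)) <= e * normc (w - z)) ->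
  derivable f z 1.
Proof.
move=> H; apply/cvg_ex; exists l; apply/cvgCP => e e0.
have [d d0 {}H] := H _ (divr_gt0 e0 (ltr0Sn R 1)).
apply/nbhsCP; exists d => // h.
rewrite subr0 => hd h0 /=; have := H (h + z).
rewrite (_ : h%:A + z = h + z); last by congr (_ + _); exact: mulr1.
rewrite addrK => /(_ hd) {}H.
rewrite (_ : _ - l = h^-1 * (f (h + z) - f z - l * h)); last first.
  by rewrite [RHS]mulrBr [in RHS]mulrCA mulVf// mulr1.
rewrite normcM normcV; have h0' := normc_gt0 h0.
apply: le_lt_trans (ler_wpM2l _ H) _; first by rewrite invr_ge0 ltW.
rewrite mulrCA mulVf ?lt0r_neq0// mulr1; lra.
Qed.

Lemma continuousC_cst (k z : CC R) : {for z, continuous (fun=> k : CC R)}.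
Proof. exact: cst_continuous. Qed.
Lemma continuousC_id (z : CC R) : {for z, continuous (fun z : CC R=> z : CC R)}.
Proof. by move=> A. Qed.

Lemma continuousCD (f g : CC R -> CC R) (z : CC R) : {for z, continuous f} -> {for z, continuous g} ->
  {for z, continuous (fun z => f z + g z : CC R)}.
Proof. by move=> cf cg; apply: (@continuousD R[i] (CC R) (CC R)); [exact: cf|exact: cg]. Qed.
Lemma continuousCB (f g : CC R -> CC R) (z : CC R) : {for z, continuous f} -> {for z, continuous g} ->
  {for z, continuous (fun z => f z - g z : CC R)}.
Proof. by move=> cf cg; apply: (@continuousB R[i] (CC R) (CC R)); [exact: cf|exact: cg]. Qed.
Lemma continuousCM (f g : CC R -> CC R) (z : CC R) : {for z, continuous f} -> {for z, continuous g} ->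
  {for z, continuous (fun z => f z * g z : CC R)}.
Proof. move=> cf cg. apply: (@continuousM R[i] (CC R)).
exact: cf.
exact: cg. Qed.
Lemma continuousC_affine (k l z : CC R) :
  {for z, continuous (fun z => k + l * z : CC R)}.
Proof.
apply: continuousCD; first exact: continuousC_cst.
by apply: continuousCM; [exact: continuousC_cst|exact: continuousC_id].
Qed.

Lemma derivableCD (f g : CC R -> CC R) (z : CC R) : derivable f z 1 -> derivable g z 1 ->
  derivable (fun z => f z + g z : CC R) z 1.
Proof. move=> cf cg. apply: (@derivableD R[i] (CC R) (CC R)).
exact: cf.
exact: cg. Qed.
Lemma derivableCM (f g : CC R -> CC R) (z : CC R) : derivable f z 1 -> derivable g z 1 ->
  derivable (fun z => f z * g z : CC R) z 1.
Proof. move=> cf cg. apply: (@derivableM R[i] (CC R)).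
exact: cf.
exact: cg. Qed.
Lemma derivableCV (f : CC R -> CC R) (z : CC R) : derivable f z 1 -> f z != 0 ->
  derivable (fun z => (f z)^-1 : CC R) z 1.
Proof. move=> cf cg. apply: (@derivableV R[i] (CC R)).
exact: cg.
exact: cf. Qed.
Lemma derivableC_comp (f g : CC R -> CC R) (z : CC R) : derivable f z 1 -> derivable g (f z) 1 ->
  derivable (fun z => g (f z) : CC R) z 1.
Proof. move=> /derivable1_diffP cf /derivable1_diffP cg. apply/derivable1_diffP.
apply: (@differentiable_comp R[i] (CC R) (CC R) (CC R)).
exact: cf.
exact: cg. Qed.

End Complex.

(** * Integrals of complex functions of a real variable *)

Section Integral.
Context {R : realType}.
Implicit Types (a b c d x y t : R) (phi psi : R -> CC R) (f g : R -> R).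

Definition rint a b f : R := \int[lebesgue_measure]_(t in `[a, b]) f t.

(** Two-sided continuity at every point of the closed interval: all the
    functions integrated below are continuous beyond the ends of the interval. *)
Definition cont_on (V : topologicalType) a b (f : R -> V) :=
  forall t, a <= t <= b -> {for t, continuous f}.

Lemma cont_on_within (V : topologicalType) a b (f : R -> V) :
  cont_on a b f -> {within `[a, b], continuous f}.
Proof.
move=> cf; apply: continuous_in_subspaceT => t; rewrite inE/= in_itv/=.
exact: cf.
Qed.

Lemma cont_on_integrable a b f : cont_on a b f ->
  lebesgue_measure.-integrable `[a, b] (EFin \o f).
Proof.
move=> /cont_on_within cf; apply: continuous_compact_integrable => //.
exact: segment_compact.
Qed.

Lemma rintD a b f g : cont_on a b f -> cont_on a b g ->
  rint a b (fun t => f t + g t) = rint a b f + rint a b g.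
Proof. by move=> cf cg; rewrite /rint RintegralD//; exact: cont_on_integrable. Qed.

Lemma rintZ a b k f : cont_on a b f ->
  rint a b (fun t => k * f t) = k * rint a b f.
Proof. by move=> cf; rewrite /rint RintegralZl//; exact: cont_on_integrable. Qed.

Lemma rint_cst a b k : a <= b -> rint a b (fun=> k) = k * (b - a).
Proof.
move=> ab; rewrite /rint Rintegral_cst//= lebesgue_measure_itv/= lte_fin.
by move: ab; rewrite le_eqVlt => /predU1P[->|->]; rewrite ?ltxx ?subrr//= subrr.
Qed.

Lemma rint_id a b : a <= b -> rint a b id = (b ^+ 2 - a ^+ 2) / 2.
Proof.
rewrite le_eqVlt => /predU1P[->|ab].
  by rewrite subrr mul0r /rint set_itv1 Rintegral_set1.
pose F : R -> R := fun x => x ^+ 2 / 2.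
have Fd x : derivable F x 1.
  apply: derivableM; first exact: exprn_derivable.
  exact: derivable_cst.
have Fc : continuous F.
  by move=> x; apply: differentiable_continuous; exact/derivable1_diffP.
rewrite /rint /Rintegral (@continuous_FTC2 _ id F)//.
- by rewrite /= /F mulrBl.
- by apply: continuous_subspaceT => x; exact: cvg_id.
- split => [x _|//|]; first exact: Fd.
  + by apply: cvg_at_right_filter; exact: Fc.
  + by apply: cvg_at_left_filter; exact: Fc.
- move=> x _; rewrite derive1Mr; last exact: exprn_derivable.
  by rewrite exp_derive1 /= expr1 [X in X / _]mulrC mulfK.
Qed.

Lemma rint_ge0 a b f : (forall t, a <= t <= b -> 0 <= f t) -> 0 <= rint a b f.
Proof. by move=> f0; apply: Rintegral_ge0 => t /=; rewrite in_itv; exact: f0. Qed.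

Lemma le_rint a b f g : cont_on a b f -> cont_on a b g ->
  (forall t, a <= t <= b -> f t <= g t) -> rint a b f <= rint a b g.
Proof.
by move=> cf cg fg; apply: le_Rintegral => //; exact: cont_on_integrable.
Qed.

Lemma rint_split a m b f : a <= m -> m <= b -> cont_on a b f ->
  rint a b f = rint a m f + rint m b f.
Proof.
move=> am mb cf.
have := @Rintegral_itvB R f (BLeft a) (BRight b) m.
move=> /(_ (cont_on_integrable cf)); rewrite !bnd_simp => /(_ am mb) H.
rewrite /rint -(@Rintegral_itv_obnd_cbnd _ m (BRight b)) -?H ?subrKC//.
apply: (integrableS _ _ _ (cont_on_integrable cf)) => //.
apply: subset_itv; rewrite bnd_simp//.
Qed.

Definition cint a b phi : R[i] :=
  rint a b (fun t => Re (phi t)) +i* rint a b (fun t => Im (phi t)).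

Lemma cont_on_Re a b phi : cont_on a b phi -> cont_on a b (fun t => Re (phi t)).
Proof. by move=> cf t /cf ct; apply: continuous_comp ct _; exact: continuous_Re. Qed.

Lemma cont_on_Im a b phi : cont_on a b phi -> cont_on a b (fun t => Im (phi t)).
Proof. by move=> cf t /cf ct; apply: continuous_comp ct _; exact: continuous_Im. Qed.

Lemma cont_on_normc a b phi : cont_on a b phi -> cont_on a b (fun t => normc (phi t)).
Proof. by move=> cf t /cf ct; apply: continuous_comp ct _; exact: continuous_normc. Qed.

Lemma cont_onM a b f g : cont_on a b f -> cont_on a b g ->
  cont_on a b (fun t => f t * g t).
Proof. by move=> cf cg t tab; apply: cvgM; [exact: cf|exact: cg]. Qed.

Lemma cont_onD a b f g : cont_on a b f -> cont_on a b g ->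
  cont_on a b (fun t => f t + g t).
Proof. by move=> cf cg t tab; apply: cvgD; [exact: cf|exact: cg]. Qed.

Lemma cont_on_cst (V : topologicalType) a b (k : V) : cont_on a b (fun=> k).
Proof. by move=> t _; exact: cvg_cst. Qed.

Lemma cont_onMC a b phi psi : cont_on a b phi -> cont_on a b psi ->
  cont_on a b (fun t => (phi t * psi t : CC R)).
Proof. by move=> cf cg t tab; apply: (@cvgM R[i]); [exact: cf|exact: cg]. Qed.

Lemma eq_rint a b f g : (forall t, a <= t <= b -> f t = g t) ->
  rint a b f = rint a b g.
Proof. by move=> fg; apply: eq_Rintegral => t; rewrite inE/= in_itv; exact: fg. Qed.

Lemma eq_cint a b phi psi : (forall t, a <= t <= b -> phi t = psi t) ->
  cint a b phi = cint a b psi.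
Proof. by move=> e; rewrite /cint; congr (_ +i* _); apply: eq_rint => t /e ->. Qed.

Lemma cintD a b phi psi : cont_on a b phi -> cont_on a b psi ->
  cint a b (fun t => phi t + psi t) = cint a b phi + cint a b psi.
Proof.
move=> cf cg; rewrite /cint.
have rE : forall t, a <= t <= b -> Re (phi t + psi t) = Re (phi t) + Re (psi t).
  by move=> t _; case: (phi t) (psi t) => [? ?] [? ?].
have iE : forall t, a <= t <= b -> Im (phi t + psi t) = Im (phi t) + Im (psi t).
  by move=> t _; case: (phi t) (psi t) => [? ?] [? ?].
rewrite (eq_rint rE) (eq_rint iE) !rintD//; do ?exact: cont_on_Re; exact: cont_on_Im.
Qed.

Lemma cintZ a b (k : R[i]) phi : cont_on a b phi ->
  cint a b (fun t => k * phi t) = k * cint a b phi.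
Proof.
move=> cf; case: k => p q; rewrite /cint.
have rE : forall t, a <= t <= b -> Re ((p +i* q) * phi t) = p * Re (phi t) + - q * Im (phi t).
  by move=> t _; case: (phi t) => [? ?] /=; rewrite mulNr.
have iE : forall t, a <= t <= b -> Im ((p +i* q) * phi t) = p * Im (phi t) + q * Re (phi t).
  by move=> t _; case: (phi t) => [? ?] /=.
have cr := cont_on_Re cf; have ci := cont_on_Im cf.
rewrite (eq_rint rE) (eq_rint iE) !rintD ?rintZ//; try (by apply: cont_onM => //; exact: cont_on_cst).
by rewrite /= mulNr.
Qed.

Lemma cint_cst a b (k : R[i]) : a <= b -> cint a b (fun=> k) = k * (b - a)%:C.
Proof.
move=> ab; rewrite /cint !rint_cst//; case: k => p q /=.
by apply/eqP; rewrite eq_complex /= !mulr0 subr0 add0r !eqxx.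
Qed.

Lemma cint_id a b : a <= b ->
  cint a b (fun t => t%:C) = ((b ^+ 2 - a ^+ 2) / 2)%:C.
Proof. by move=> ab; rewrite /cint /= -(rint_id ab) rint_cst// mul0r. Qed.

Lemma cint_split a m b phi : a <= m -> m <= b -> cont_on a b phi ->
  cint a b phi = cint a m phi + cint m b phi.
Proof.
move=> am mb cf.
by rewrite /cint (rint_split am mb (cont_on_Re cf)) (rint_split am mb (cont_on_Im cf)).
Qed.

(** Multiplying by the conjugate of the integral I turns I into its squared
    modulus, an integral of real parts. *)
Lemma normc_cint_le a b phi : cont_on a b phi ->
  normc (cint a b phi) <= rint a b (fun t => normc (phi t)).
Proof.
move=> cf; set I := cint a b phi.
have [->|I0] := eqVneq I 0; first by rewrite normc0; apply: rint_ge0 => t _; exact: normc_ge0.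
rewrite -(ler_pM2l (normc_gt0 I0)) -expr2 normc_sqr.
have cn := cont_on_normc cf; have cr := cont_on_Re cf; have ci := cont_on_Im cf.
rewrite -rintZ//.
rewrite [leLHS](_ : _ = rint a b (fun t => Re I * Re (phi t) + Im I * Im (phi t))); last first.
  by rewrite rintD ?rintZ// ?expr2//; apply: cont_onM => //; exact: cont_on_cst.
apply: le_rint => [||t _].
- by apply: cont_onD; apply: cont_onM => //; exact: cont_on_cst.
- by apply: cont_onM => //; exact: cont_on_cst.
(* Re(conj(I) phi) <= |conj(I) phi| = |I phi| *)
rewrite -normcM; set J := I in |- *.
have -> : normc (J * phi t) = normc (J^*%C * phi t).
  by rewrite !normcM; congr (_ * _); case: (J) => p q /=; rewrite sqrrN.
apply: le_trans (ler_norm _) _.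
rewrite (_ : Re J * _ + _ = Re (J^*%C * phi t)); first exact: normRe.
by case: (J) (phi t) => [p q] [u v] /=; rewrite mulNr opprK.
Qed.

Lemma normc_cint_le_cst a b phi (M : R) : a <= b -> cont_on a b phi ->
  (forall t, a <= t <= b -> normc (phi t) <= M) ->
  normc (cint a b phi) <= M * (b - a).
Proof.
move=> ab cf phiM; apply: le_trans (normc_cint_le cf) _.
rewrite -rint_cst//; apply: le_rint => //; first exact: cont_on_normc.
exact: cont_on_cst.
Qed.

(** Jensen: the variance of f about its mean m is nonnegative. *)
Lemma rint_sqr_le a b f : a <= b -> cont_on a b f ->
  rint a b f ^+ 2 <= (b - a) * rint a b (fun t => f t ^+ 2).
Proof.
move=> ab cf; have [->|ba0] := eqVneq b a.
  by rewrite subrr mul0r /rint set_itv1 Rintegral_set1 expr0n.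
have {}ba0 : 0 < b - a by rewrite subr_gt0 lt_neqAle eq_sym ba0.
pose m := rint a b f / (b - a).
have cf2 : cont_on a b (fun t => f t ^+ 2) by exact: cont_onM.
have : 0 <= rint a b (fun t => f t ^+ 2 + (- (2 * m) * f t + m ^+ 2)).
  apply: rint_ge0 => t _.
  rewrite (_ : _ + _ = (f t - m) ^+ 2) ?sqr_ge0//; ring.
have cm : cont_on a b (fun t => - (2 * m) * f t).
  by apply: cont_onM => //; exact: cont_on_cst.
rewrite rintD//; last by apply: cont_onD => //; exact: cont_on_cst.
rewrite rintD//; last exact: cont_on_cst.
rewrite rintZ// rint_cst//.
have mE : rint a b f = m * (b - a) by rewrite divfK// lt0r_neq0.
rewrite mE.
set S := rint a b _; nra.
Qed.

End Integral.

(** * Bisection of rectangles *)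

Section Bisection.
Context {R : realType}.
Implicit Types a b c d : R.

Lemma half_powers_small (w e : R) : 0 < e -> exists n : nat, w / 2 ^+ n < e.
Proof.
move=> e0; have [n nw] : exists n : nat, `|w| / e < n%:R.
  by exists (Num.truncn (`|w| / e)).+1; exact: truncnS_gt.
exists n; rewrite ltr_pdivrMr ?exprn_gt0//; apply: le_lt_trans (ler_norm _) _.
move: nw; rewrite ltr_pdivrMr// => /lt_le_trans; apply.
by rewrite mulrC ler_pM2l// -natrX ler_nat ltnW// ltn_expl.
Qed.

Lemma nested_intervals (u : nat -> R) (w : R) : 0 <= w ->
  (forall n, u n <= u n.+1 /\ u n.+1 + w / 2 ^+ n.+1 <= u n + w / 2 ^+ n) ->
  exists p, forall n, u n <= p <= u n + w / 2 ^+ n.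
Proof.
move=> w0 uS.
have um n k : u n <= u (n + k)%N /\ u (n + k)%N + w / 2 ^+ (n + k) <= u n + w / 2 ^+ n.
  elim: k => [|k [IH1 IH2]]; first by rewrite addn0.
  rewrite addnS; have [S1 S2] := uS (n + k)%N.
  by split; [exact: le_trans S1|exact: le_trans IH2].
have wn n : 0 <= w / 2 ^+ n by rewrite divr_ge0// exprn_ge0.
have ub n : ubound (range u) (u n + w / 2 ^+ n).
  move=> _ [m _ <-]; have [nm|/ltnW mn] := leqP n m.
    have [_] := um n (m - n)%N; rewrite subnKC//; have := wn m; lra.
  have [] := um m (n - m)%N; rewrite subnKC//; have := wn n; lra.
exists (sup (range u)) => n; apply/andP; split.
  by apply: ub_le_sup; [exists (u 0%N + w / 2 ^+ 0); exact: ub|exists n].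
by apply: ge_sup; [exists (u 0%N); exists 0%N|exact: ub].
Qed.

(** If P fails on the whole rectangle, it fails on one of its quarters; iterating
    gives rectangles that shrink to a point (p, q), near which P holds. *)
Lemma rectangle_bisection (P : R -> R -> R -> R -> Prop) a0 b0 c0 d0 :
  a0 <= b0 -> c0 <= d0 ->
  (forall a b c d, a0 <= a -> a <= b -> b <= b0 -> c0 <= c -> c <= d -> d <= d0 ->
     P a ((a + b) / 2) c ((c + d) / 2) -> P ((a + b) / 2) b c ((c + d) / 2) ->
     P a ((a + b) / 2) ((c + d) / 2) d -> P ((a + b) / 2) b ((c + d) / 2) d ->
     P a b c d) ->
  (forall p q, a0 <= p <= b0 -> c0 <= q <= d0 -> exists2 e : R, 0 < e &
     forall a b c d, a0 <= a -> a <= p <= b -> b <= b0 -> c0 <= c -> c <= q <= d ->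
       d <= d0 -> b - a < e -> d - c < e -> P a b c d) ->
  P a0 b0 c0 d0.
Proof.
move=> ab cd Hq Hloc; apply: contrapT => nP.
set w := b0 - a0; set h := d0 - c0.
have w0 : 0 <= w by rewrite subr_ge0.
have h0 : 0 <= h by rewrite subr_ge0.
(* Q n s: the n-th rectangle with lower left corner s lies in the original one
   and violates P; T n s s': the corner s' is that of a subrectangle at step n + 1. *)
pose Q n (s : R * R) := [/\ a0 <= s.1, s.1 + w / 2 ^+ n <= b0, c0 <= s.2,
  s.2 + h / 2 ^+ n <= d0 & ~ P s.1 (s.1 + w / 2 ^+ n) s.2 (s.2 + h / 2 ^+ n)].
pose T n (s s' : R * R) := [/\ s.1 <= s'.1,
  s'.1 + w / 2 ^+ n.+1 <= s.1 + w / 2 ^+ n, s.2 <= s'.2 &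
  s'.2 + h / 2 ^+ n.+1 <= s.2 + h / 2 ^+ n].
have step (ns : nat * (R * R)) : exists s', Q ns.1 ns.2 -> T ns.1 ns.2 s' /\ Q ns.1.+1 s'.
  case: ns => n [a c] /=.
  have [[/= aa ab' cc cd' nP']|] := pselect (Q n (a, c)); last by exists (0, 0).
  set wn := w / 2 ^+ n.+1; set hn := h / 2 ^+ n.+1.
  have wE : w / 2 ^+ n = wn + wn.
    by rewrite /wn exprS invfM; field; rewrite expf_neq0.
  have hE : h / 2 ^+ n = hn + hn.
    by rewrite /hn exprS invfM; field; rewrite expf_neq0.
  have wn0 : 0 <= wn by rewrite divr_ge0// exprn_ge0.
  have hn0 : 0 <= hn by rewrite divr_ge0// exprn_ge0.
  apply: contrapT => nE.
  have {}nE a' c' : a <= a' -> a' <= a + wn -> c <= c' -> c' <= c + hn ->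
      P a' (a' + wn) c' (c' + hn).
    move=> h1 h2 h3 h4; apply: contrapT => nP''; apply: nE; exists (a', c') => _.
    by rewrite /T /Q /= -/wn -/hn wE hE; split; split=> //; lra.
  apply: nP'; rewrite wE hE.
  have mE : (a + (a + (wn + wn))) / 2 = a + wn by lra.
  have kE : (c + (c + (hn + hn))) / 2 = c + hn by lra.
  by apply: Hq; rewrite ?mE ?kE ?(addrA _ wn) ?(addrA _ hn); try lra; apply: nE; lra.
have [g gP] := @choice _ _ (fun ns s' => Q ns.1 ns.2 -> T ns.1 ns.2 s' /\ Q ns.1.+1 s') step.
pose fix s n := if n is n'.+1 then g (n', s n') else (a0, c0).
have sQ n : Q n (s n).
  elim: n => [|n IH]; last by have [] := gP (n, s n) IH.
  rewrite /Q /= expr0 !divr1 /w /h !subrKC; split=> //.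
have sT n : T n (s n) (s n.+1) by have [] := gP (n, s n) (sQ n).
have [p pP] := @nested_intervals (fun n => (s n).1) w w0 (fun n => let: And4 x y _ _ := sT n in conj x y).
have [q qP] := @nested_intervals (fun n => (s n).2) h h0 (fun n => let: And4 _ _ x y := sT n in conj x y).
have [|| e e0 He] := Hloc p q.
- by have := pP 0%N; rewrite /= expr0 divr1 subrKC.
- by have := qP 0%N; rewrite /= expr0 divr1 subrKC.
have [n nw] := half_powers_small (w + h) e0.
have [H1 H2 H3 H4] := sQ n; apply.
have wn0 : 0 <= w / 2 ^+ n by rewrite divr_ge0// exprn_ge0.
have hn0 : 0 <= h / 2 ^+ n by rewrite divr_ge0// exprn_ge0.
move: nw; rewrite mulrDl => nw.
by apply: He => //; lra.
Qed.

End Bisection.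

(** * Contour integrals over rectangles *)

Section Goursat.
Context {R : realType}.
Implicit Types (a b c d : R) (f g : CC R -> CC R).

(** The counterclockwise integral of f over the boundary of [a,b] x [c,d]. *)
Definition rect_int f a b c d : R[i] :=
  cint a b (fun x => f (x +i* c)) - cint a b (fun x => f (x +i* d)) +
  'i%C * (cint c d (fun y => f (b +i* y)) - cint c d (fun y => f (a +i* y))).

Lemma cont_on_hline f a b c :
  (forall x, a <= x <= b -> {for x +i* c, continuous f}) ->
  cont_on a b (fun x => f (x +i* c)).
Proof.
move=> cf x xab; apply: (@continuous_comp _ _ _ (fun x => x +i* c : CC R)); last exact: cf.
by apply: continuousC2; [exact: cvg_id|exact: cvg_cst].
Qed.

Lemma cont_on_vline f a c d :
  (forall y, c <= y <= d -> {for a +i* y, continuous f}) ->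
  cont_on c d (fun y => f (a +i* y)).
Proof.
move=> cf x xab; apply: (@continuous_comp _ _ _ (fun x => a +i* x : CC R)); last exact: cf.
by apply: continuousC2; [exact: cvg_cst|exact: cvg_id].
Qed.

(** The two integrals over the common vertical side cancel. *)
Lemma rect_int_vsplit f a m b c d : a <= m -> m <= b ->
  cont_on a b (fun x => f (x +i* c)) -> cont_on a b (fun x => f (x +i* d)) ->
  rect_int f a b c d = rect_int f a m c d + rect_int f m b c d.
Proof.
move=> am mb cc cd; rewrite /rect_int (cint_split am mb cc) (cint_split am mb cd).
ring.
Qed.

Lemma rect_int_hsplit f a b c m d : c <= m -> m <= d ->
  cont_on c d (fun y => f (a +i* y)) -> cont_on c d (fun y => f (b +i* y)) ->
  rect_int f a b c d = rect_int f a b c m + rect_int f a b m d.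
Proof.
move=> am mb cc cd; rewrite /rect_int (cint_split am mb cc) (cint_split am mb cd).
ring.
Qed.

Definition rect a b c d : set (CC R) := [set z | a <= Re z <= b /\ c <= Im z <= d].

Definition cont_rect f a b c d := forall z, rect a b c d z -> {for z, continuous f}.

(** Continuity is asked of the restrictions to the sides only, since rectangles
    containing a singular point in their interior occur below. *)
Definition cont_sides f a b c d :=
  [/\ cont_on a b (fun x => f (x +i* c)), cont_on a b (fun x => f (x +i* d)),
      cont_on c d (fun y => f (a +i* y)) & cont_on c d (fun y => f (b +i* y))].

Lemma cont_rect_sides f a b c d : a <= b -> c <= d -> cont_rect f a b c d ->
  cont_sides f a b c d.
Proof.
move=> ab cd cf; split; (apply: cont_on_hline || apply: cont_on_vline);
  by move=> t tab; apply: cf; split; rewrite //= lexx ?andbT.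
Qed.

Lemma rect_int_le f a b c d (M : R) : a <= b -> c <= d ->  cont_sides f a b c d ->
  (forall x, a <= x <= b -> normc (f (x +i* c)) <= M /\ normc (f (x +i* d)) <= M) ->
  (forall y, c <= y <= d -> normc (f (a +i* y)) <= M /\ normc (f (b +i* y)) <= M) ->
  normc (rect_int f a b c d) <= M * ((b - a) + (d - c)) *+ 2.
Proof.
move=> ab cd [c1 c2 c3 c4] f1 f2; rewrite /rect_int.
apply: le_trans (le_normcD _ _) _.
have n1 : normc ('i%C : R[i]) = 1 by rewrite /= expr0n expr1n add0r sqrtr1.
rewrite normcM n1 mul1r mulrDr mulrnDl.
apply: lerD; apply: le_trans (le_normcD _ _) _; rewrite normcN mulr2n.
  by apply: lerD; apply: normc_cint_le_cst => // t /f1[].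
by apply: lerD; apply: normc_cint_le_cst => // t /f2[].
Qed.

Lemma rect_intD f g a b c d : cont_sides f a b c d ->
  cont_sides g a b c d ->
  rect_int (fun z => f z + g z) a b c d = rect_int f a b c d + rect_int g a b c d.
Proof. by move=> [? ? ? ?] [? ? ? ?]; rewrite /rect_int !cintD//; ring. Qed.

Lemma rect_intZ f k a b c d : cont_sides f a b c d ->
  rect_int (fun z => k * f z) a b c d = k * rect_int f a b c d.
Proof. by move=> [? ? ? ?]; rewrite /rect_int !cintZ//; ring. Qed.

Lemma rect_int_cst k a b c d : a <= b -> c <= d ->
  rect_int (fun=> k : CC R) a b c d = 0.
Proof. by move=> ab cd; rewrite /rect_int !cint_cst//; ring. Qed.

Lemma rect_int_id a b c d : a <= b -> c <= d ->
  rect_int (fun z => z) a b c d = 0.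
Proof.
move=> ab cd.
have xE (k x : R) : x +i* k = x%:C + k *i.
  by apply/eqP; rewrite eq_complex /=; apply/andP; split; apply/eqP; ring.
have yE (k y : R) : k +i* y = k%:C + 'i%C * y%:C :> R[i].
  by apply/eqP; rewrite eq_complex /=; apply/andP; split; apply/eqP; ring.
have cR u v : cont_on u v (fun x => x%:C : CC R).
  by move=> t _; apply: continuousC2; [exact: cvg_id|exact: cvg_cst].
have cK u v (k : CC R) : cont_on u v (fun=> k) by exact: cont_on_cst.
rewrite /rect_int.
rewrite (eq_cint (fun t _ => xE c t)) (eq_cint (fun t _ => xE d t)).
rewrite (eq_cint (fun t _ => yE b t)) (eq_cint (fun t _ => yE a t)).
rewrite !cintD ?cintZ ?cint_cst ?cint_id//; try by [apply: cont_onMC].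
by apply/eqP; rewrite eq_complex /=; apply/andP; split; apply/eqP; field.
Qed.

Lemma rect_int_affine k l a b c d : a <= b -> c <= d ->
  rect_int (fun z => k + l * z : CC R) a b c d = 0.
Proof.
move=> ab cd.
have cK : cont_sides (fun=> k : CC R) a b c d.
  by apply: cont_rect_sides => // z _; exact: continuousC_cst.
have cI : cont_sides (fun z => z : CC R) a b c d.
  by apply: cont_rect_sides => // z _; exact: continuousC_id.
have cl : cont_sides (fun z => l * z : CC R) a b c d.
  apply: cont_rect_sides => // z _; apply: continuousCM.
    exact: continuousC_cst.
  exact: continuousC_id.
rewrite (rect_intD cK cl) (rect_intZ l cI) rect_int_cst// rect_int_id//.
by rewrite mulr0 addr0.
Qed.

End Goursat.

(** * Goursat's theorem *)

Section CauchyGoursat.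
Context {R : realType}.
Implicit Types (a b c d : R) (f g : CC R -> CC R).

Lemma derivable_cont_rect f a b c d :
  (forall z, rect a b c d z -> derivable f z 1) -> cont_rect f a b c d.
Proof. by move=> df z /df; exact: derivable_continuousC. Qed.

Lemma sub_rect a b c d a' b' c' d' : a <= a' -> b' <= b -> c <= c' -> d' <= d ->
  rect a' b' c' d' `<=` rect a b c d.
Proof.
by move=> h1 h2 h3 h4 z [/andP[h5 h6] /andP[h7 h8]]; split; apply/andP; split; lra.
Qed.

(** Up to an error e |z - p|, f is affine near each point p, and affine functions have
    zero integral.  So the integral over a small rectangle containing p is at
    most e times its squared size, a bound inherited from the four quarters of a
    rectangle by the rectangle itself.  Bisection propagates it to the whole. *)
Theorem goursat f a b c d : a <= b -> c <= d ->
  (forall z, rect a b c d z -> derivable f z 1) -> rect_int f a b c d = 0.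
Proof.
move=> ab cd df.
have cf := derivable_cont_rect df.
suff H e : 0 < e -> normc (rect_int f a b c d) <= e * ((b - a) + (d - c)) ^+ 2.
  apply: eq0_normc; apply/eqP; rewrite eq_le normc_ge0 andbT.
  set s := _ ^+ 2 in H; have s0 : 0 <= s by exact: sqr_ge0.
  apply/ler_addgt0Pr => e e0; rewrite add0r.
  apply: le_trans (H (e / (s + 1)) _) _; first by rewrite divr_gt0// ltr_wpDl.
  by rewrite mulrAC ler_pdivrMr ?ltr_wpDl// ler_pM2l// lerDl.
move=> e0.
apply: (rectangle_bisection (P := fun a b c d =>
  normc (rect_int f a b c d) <= e * ((b - a) + (d - c)) ^+ 2)) => //.
  move=> a1 b1 c1 d1 aa ab1 bb cc cd1 dd.
  set m := (a1 + b1) / 2; set k := (c1 + d1) / 2 => H1 H2 H3 H4.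
  have cfs a2 b2 c2 d2 : a1 <= a2 -> a2 <= b2 -> b2 <= b1 -> c1 <= c2 ->
      c2 <= d2 -> d2 <= d1 -> cont_sides f a2 b2 c2 d2.
    move=> *; apply: cont_rect_sides => // z zr; apply: cf.
    by move: zr; apply: sub_rect; [exact: le_trans aa _|exact: le_trans bb|exact: le_trans cc _|exact: le_trans dd].
  have [s1 s2 s3 s4] : cont_sides f a1 b1 c1 d1 by apply: cfs.
  have /andP[am mb] : a1 <= m <= b1 by rewrite !midf_le.
  have /andP[ck kd] : c1 <= k <= d1 by rewrite !midf_le.
  have [_ _ _ s5] : cont_sides f a1 m c1 d1 by apply: cfs.
  rewrite (rect_int_vsplit am mb s1 s2) (rect_int_hsplit ck kd s3 s5).
  rewrite (rect_int_hsplit ck kd s5 s4).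
  apply: le_trans (le_normcD _ _) _.
  apply: le_trans (lerD (le_normcD _ _) (le_normcD _ _)) _.
  apply: le_trans (lerD (lerD H1 H3) (lerD H2 H4)) _.
  rewrite -!mulrDr ler_pM2l// le_eqVlt; apply/orP; left; apply/eqP.
  by rewrite /m /k; field.
move=> p q pab qcd.
have [|l /(_ (e / 2))[|dl d0 Hl]] := derivable_expansion (df (p +i* q) _).
- by split.
- by rewrite divr_gt0.
exists (dl / 2); first by rewrite divr_gt0.
move=> a1 b1 c1 d1 aa /andP[ap pb] bb cc /andP[cq qd] dd wd hd.
have ab1 := le_trans ap pb; have cd1 := le_trans cq qd.
set z0 := p +i* q in Hl.
have cf1 : cont_rect f a1 b1 c1 d1 by move=> z zr; apply: cf; apply: sub_rect zr.
pose r z := f z - f z0 - l * (z - z0).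
have cr : cont_rect r a1 b1 c1 d1.
  move=> z zr; apply: continuousCB.
    by apply: continuousCB; [exact: cf1|exact: continuousC_cst].
  apply: continuousCM; first exact: continuousC_cst.
  by apply: continuousCB; [exact: continuousC_id|exact: continuousC_cst].
have fE : f = (fun z => (f z0 - l * z0 + l * z) + r z).
  by apply/funext => z; rewrite /r; ring.
have cr' := cont_rect_sides ab1 cd1 cr.
have cA : cont_sides (fun z => (f z0 - l * z0) + l * z : CC R) a1 b1 c1 d1.
  exact: (cont_rect_sides ab1 cd1 (fun z _ => @continuousC_affine R (f z0 - l * z0) l z)).
have -> : rect_int f a1 b1 c1 d1 = rect_int r a1 b1 c1 d1.
  by rewrite fE (rect_intD cA cr') rect_int_affine// add0r.
have rle z : rect a1 b1 c1 d1 z -> normc (r z) <= e / 2 * ((b1 - a1) + (d1 - c1)).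
  move=> [/andP[h1 h2] /andP[h3 h4]].
  have zz : normc (z - z0) <= (b1 - a1) + (d1 - c1).
    apply: le_trans (normc_leD _) _; rewrite /z0.
    case: z h1 h2 h3 h4 => u v /= h1 h2 h3 h4.
    by apply: lerD; rewrite ler_norml; lra.
  apply: le_trans (Hl z _) _; first by apply: le_lt_trans zz _; lra.
  by rewrite ler_pM2l// divr_gt0.
apply: le_trans (rect_int_le (M := e / 2 * ((b1 - a1) + (d1 - c1))) ab1 cd1 cr' _ _) _.
- by move=> t tab; split; apply: rle; split; rewrite //= lexx ?andbT.
- by move=> t tab; split; apply: rle; split; rewrite //= lexx ?andbT.
by rewrite mulr2n; lra.
Qed.

(** Cut along the four lines bounding the small rectangle: the four discarded
    pieces avoid the singular point. *)
Lemma rect_int_excise g (p q : R) a b c d a' b' c' d' :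
  a <= a' -> a' < p -> p < b' -> b' <= b ->
  c <= c' -> c' < q -> q < d' -> d' <= d ->
  (forall z, rect a b c d z -> z != p +i* q -> derivable g z 1) ->
  rect_int g a b c d = rect_int g a' b' c' d'.
Proof.
move=> aa ap pb bb cc cq qd dd dg.
have cg z : rect a b c d z -> z != p +i* q -> {for z, continuous g}.
  by move=> h1 h2; apply: derivable_continuousC; exact: dg.
have ne u v : u != p \/ v != q -> u +i* v != p +i* q.
  by rewrite eq_complex /= negb_and => -[->|->]; rewrite ?orbT.
have hl v a1 b1 : v != q -> c <= v <= d -> a <= a1 -> b1 <= b ->
    cont_on a1 b1 (fun x => g (x +i* v)).
  move=> vq vcd a1a b1b; apply: cont_on_hline => x /andP[x1 x2].
  by apply: cg; [split => //=; lra|apply: ne; right].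
have vl u c1 d1 : u != p -> a <= u <= b -> c <= c1 -> d1 <= d ->
    cont_on c1 d1 (fun y => g (u +i* y)).
  move=> vq vcd a1a b1b; apply: cont_on_vline => x /andP[x1 x2].
  by apply: cg; [split => //=; lra|apply: ne; left].
have z0 a1 b1 c1 d1 : a <= a1 -> a1 <= b1 -> b1 <= b -> c <= c1 -> c1 <= d1 -> d1 <= d ->
    ~ rect a1 b1 c1 d1 (p +i* q) -> rect_int g a1 b1 c1 d1 = 0.
  move=> h1 h2 h3 h4 h5 h6 nr; apply: goursat => // z zr.
  apply: dg; first by apply: sub_rect zr.
  by apply/eqP => zE; apply: nr; rewrite -zE.
have nt (u v : R) : u < v -> u != v by move=> uv; rewrite lt_eqF.
have nt' (u v : R) : v < u -> u != v by move=> uv; rewrite gt_eqF.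
have h1 : cont_on a b (fun x => g (x +i* c)) by apply: hl => //; [apply: nt|]; lra.
have h2 : cont_on a b (fun x => g (x +i* d)) by apply: hl => //; [apply: nt'|]; lra.
rewrite (@rect_int_vsplit _ g a a' b)//; last lra.
rewrite [X in X + _](_ : _ = 0) ?add0r; last first.
  by apply: z0; rewrite //; try lra; move=> [/= ]; lra.
rewrite (@rect_int_vsplit _ g a' b' b)//; [|lra| |]; last 2 first.
- by apply: hl => //; [apply: nt|]; lra.
- by apply: hl => //; [apply: nt'|]; lra.
rewrite [X in _ + X](_ : _ = 0) ?addr0; last first.
  by apply: z0; rewrite //; try lra; move=> [/= ]; lra.
rewrite (@rect_int_hsplit _ g a' b' c c' d)//; [|lra| |]; last 2 first.
- by apply: vl => //; [apply: nt|]; lra.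
- by apply: vl => //; [apply: nt'|]; lra.
rewrite [X in X + _](_ : _ = 0) ?add0r; last first.
  by apply: z0; rewrite //; try lra; move=> [/= _]; lra.
rewrite (@rect_int_hsplit _ g a' b' c' d' d)//; [|lra| |]; last 2 first.
- by apply: vl => //; [apply: nt|]; lra.
- by apply: vl => //; [apply: nt'|]; lra.
rewrite [X in _ + X](_ : _ = 0) ?addr0//.
by apply: z0; rewrite //; try lra; move=> [/= _]; lra.
Qed.

End CauchyGoursat.

(** * Cauchy's formula on a rectangle *)

Section CauchySquare.
Context {R : realType}.
Implicit Types (f g : CC R -> CC R) (x z : CC R).

(** The quotient g(z) = (f(z) - f(x)) / (z - x) is bounded near x, so its integral over a
    small square around x tends to 0 with the side; by excision it equals the
    integral over the whole rectangle. *)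
Lemma rect_cauchy f x a b c d : a < Re x < b -> c < Im x < d ->
  (forall z, rect a b c d z -> derivable f z 1) ->
  rect_int (fun z => f z * (z - x)^-1 : CC R) a b c d =
  f x * rect_int (fun z => (z - x)^-1 : CC R) a b c d.
Proof.
case: x => p q /= /andP[ap pb] /andP[cq qd] df; set x := p +i* q.
have ab : a <= b by rewrite ltW// (lt_trans ap).
have cd : c <= d by rewrite ltW// (lt_trans cq).
pose k z : CC R := (z - x)^-1.
pose g z : CC R := (f z - f x) * k z.
have dk z : z != x -> derivable k z 1.
  move=> zx; apply: (@derivableCV R (fun z => z - x)); last by rewrite subr_eq0.
  apply: (@derivableCD R id (fun=> - (x : CC R))); first exact: derivable_id.
  exact: derivable_cst.
have dg z : rect a b c d z -> z != x -> derivable g z 1.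
  move=> zr zx; apply: derivableCM; last exact: dk.
  apply: (@derivableCD _ f (fun=> - f x)); first exact: df.
  exact: derivable_cst.
have xr : rect a b c d x by split; rewrite /= !ltW.
have g0 : rect_int g a b c d = 0.
  have [l /(_ 1 ltr01)[dl dl0 Hl]] := derivable_expansion (df _ xr).
  pose M := normc l + 1.
  have M0 : 0 < M by rewrite ltr_wpDl// normc_ge0.
  have gM z : normc (z - x) < dl -> normc (g z) <= M.
    move=> /Hl; rewrite mul1r => H.
    rewrite /g /k normcM normcV.
    have [->|zx] := eqVneq z x; first by rewrite !subrr normc0 mul0r ltW.
    have zx0 : 0 < normc (z - x) by apply: normc_gt0; rewrite subr_eq0.
    rewrite ler_pdivrMr// /M mulrDl mul1r -normcM.
    rewrite -[f z - f x](subrK (l * (z - x))) addrC.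
    by apply: le_trans (le_normcD _ _) _; rewrite lerD2l.
  apply: eq0_normc; apply/eqP; rewrite eq_le normc_ge0 andbT.
  apply/ler_addgt0Pr => e e0; rewrite add0r.
  (* The square of half-side eta lies in the rectangle and in the disc where
     |g| <= M, and its perimeter 8 eta makes the integral at most e. *)
  pose eta := Num.min (Num.min (p - a) (b - p)) (Num.min (Num.min (q - c) (d - q))
    (Num.min (dl / 4) (e / (8 * M)))).
  have eta0 : 0 < eta by rewrite !lt_min !subr_gt0 ap pb cq qd !divr_gt0// mulr_gt0.
  have : eta <= eta by [].
  rewrite {2}/eta !le_min => /andP[/andP[e1 e2] /andP[/andP[e3 e4] /andP[e5 e6]]].
  have [e1' e2' e3' e4'] : [/\ a <= p - eta, p + eta <= b, c <= q - eta & q + eta <= d].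
    by clear -e1 e2 e3 e4; split; lra.
  have [f1 f2 f3 f4] : [/\ p - eta < p, p < p + eta, q - eta < q & q < q + eta].
    by clear -eta0; split; lra.
  rewrite (rect_int_excise e1' f1 f2 e2' e3' f3 f4 e4' dg).
  have pp : p - eta <= p + eta by clear -eta0; lra.
  have qq : q - eta <= q + eta by clear -eta0; lra.
  have near_x (z : CC R) : `|Re z - p| <= eta -> `|Im z - q| <= eta -> normc (z - x) < dl.
    move=> h1 h2; apply: le_lt_trans (normc_leD _) _.
    case: z h1 h2 => u v /= h1 h2; apply: le_lt_trans (lerD h1 h2) _.
    by clear -e5 dl0; lra.
  have ne (u v : R) : u != p \/ v != q -> u +i* v != x.
    by rewrite eq_complex /= negb_and => -[->|->]; rewrite ?orbT.
  have cg (u v : R) : `|u - p| <= eta -> `|v - q| <= eta -> u != p \/ v != q ->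
      {for (u +i* v), continuous g}.
    move=> up vq /ne uv; apply: derivable_continuousC; apply: dg => //.
    move: up vq; rewrite !ler_norml => /andP[u1 u2] /andP[v1 v2].
    by split; apply/andP; rewrite /=; clear -e1' e2' e3' e4' u1 u2 v1 v2; split; lra.
  have bd (s t : R) : s - eta <= t <= s + eta -> `|t - s| <= eta.
    by clear; rewrite ler_norml => /andP[? ?]; apply/andP; split; lra.
  have ends (s : R) : `|(s - eta) - s| <= eta /\ `|(s + eta) - s| <= eta.
    split; first by rewrite addrAC subrr add0r normrN (ger0_norm (ltW eta0)).
    by rewrite addrAC subrr add0r (ger0_norm (ltW eta0)).
  have sides : cont_sides g (p - eta) (p + eta) (q - eta) (q + eta).
    split; (apply: cont_on_hline || apply: cont_on_vline) => t /bd tb; apply: cg => //.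
    - exact: (ends q).1.
    - by right; rewrite lt_eqF.
    - exact: (ends q).2.
    - by right; rewrite gt_eqF.
    - exact: (ends p).1.
    - by left; rewrite lt_eqF.
    - exact: (ends p).2.
    - by left; rewrite gt_eqF.
  apply: le_trans (rect_int_le (M := M) pp qq sides _ _) _.
  - by move=> t /bd tb; split; apply: gM; apply: near_x => //=; [exact: (ends q).1|exact: (ends q).2].
  - by move=> t /bd tb; split; apply: gM; apply: near_x => //=; [exact: (ends p).1|exact: (ends p).2].
  move: e6; rewrite ler_pdivlMr ?mulr_gt0// => e6.
  rewrite (_ : _ *+ 2 = eta * (8 * M))//.
  by rewrite mulr2n; clear; ring.
have nex u v : u != p \/ v != q -> u +i* v != x.
  by rewrite eq_complex /= negb_and => -[->|->]; rewrite ?orbT.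
have ck : cont_sides k a b c d.
  split; (apply: cont_on_hline || apply: cont_on_vline) => t _;
    apply: derivable_continuousC; apply: dk; apply: nex.
  - by right; rewrite lt_eqF.
  - by right; rewrite gt_eqF.
  - by left; rewrite lt_eqF.
  - by left; rewrite gt_eqF.
have cg : cont_sides g a b c d.
  split; (apply: cont_on_hline || apply: cont_on_vline) => t /andP[t1 t2];
    apply: derivable_continuousC; apply: dg.
  - by split; rewrite /= ?t1 ?t2 ?lexx.
  - by apply: nex; right; rewrite lt_eqF.
  - by split; rewrite /= ?t1 ?t2 ?lexx ?andbT.
  - by apply: nex; right; rewrite gt_eqF.
  - by split; rewrite /= ?t1 ?t2 ?lexx.
  - by apply: nex; left; rewrite lt_eqF.
  - by split; rewrite /= ?t1 ?t2 ?lexx ?andbT.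
  - by apply: nex; left; rewrite gt_eqF.
have cfk : cont_sides (fun z => f x * k z : CC R) a b c d.
  case: ck => k1 k2 k3 k4.
  split.
  - by apply: cont_onMC; [exact: cont_on_cst|exact: k1].
  - by apply: cont_onMC; [exact: cont_on_cst|exact: k2].
  - by apply: cont_onMC; [exact: cont_on_cst|exact: k3].
  - by apply: cont_onMC; [exact: cont_on_cst|exact: k4].
have E : (fun z => f z * (z - x)^-1 : CC R) = (fun z => g z + f x * k z).
  by apply/funext => z; rewrite /g mulrBl subrK.
by rewrite E (rect_intD cg cfk) g0 add0r (rect_intZ _ ck).
Qed.

End CauchySquare.

(** * A mean value inequality on squares *)

Section SubMean.
Context {R : realType}.
Implicit Types (f g : CC R -> CC R) (x z : CC R).

Definition side (e : 'I_4) (t : R) : CC R :=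
  match val e with
  | 0 => t +i* - 2
  | 1 => t +i* 2
  | 2 => - 2 +i* t
  | _ => 2 +i* t
  end.

Lemma side_rect e (t : R) : - 2 <= t <= 2 -> rect (- 2) 2 (- 2) 2 (side e t).
Proof.
move=> tb; rewrite /side /rect /=; case: (val e) => [|[|[|n]]] /=; split => //;
  by apply/andP; clear; split; lra.
Qed.

Lemma continuous_side e (t : R) : {for t, continuous (side e)}.
Proof.
rewrite /side; case: (val e) => [|[|[|n]]]; apply: continuousC2;
  by [exact: cvg_id|exact: cvg_cst].
Qed.

(** For z - x = u + iv, the normal component of 1/(z - x) on a side; u and v are at
    most 3 when x is in [-1,1]^2 and z on the boundary of [-2,2]^2. *)
Lemma inv_kernel_bound (u v : R) : `|u| <= 3 -> 1 <= v <= 3 ->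
  1 / 18 <= v / (u ^+ 2 + v ^+ 2).
Proof.
move=> u3 /andP[v1 v3].
have u2 : u ^+ 2 <= 9.
  rewrite -(real_normK (num_real u)) (_ : 9 = 3 ^+ 2); last by clear; ring.
  by rewrite ler_sqr ?nnegrE.
have v2 : v ^+ 2 <= 9 by clear -v1 v3; nra.
have v2' : 1 <= v ^+ 2 by clear -v1; nra.
have u0 := sqr_ge0 u.
rewrite ler_pdivlMr; last by clear -u0 v2'; lra.
by clear -u2 v2 v1; lra.
Qed.

(** The imaginary part of the integral is a sum of four integrals over sides of
    length 4, each with an integrand at least 1/18.  (The exact value of the
    integral is 2 pi i.) *)
Lemma square_winding_bound x : rect (- 1) 1 (- 1) 1 x ->
  8 / 9 <= normc (rect_int (fun z => (z - x)^-1 : CC R) (- 2) 2 (- 2) 2).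
Proof.
case: x => p q xr.
apply: (le_trans _ (normIm _)); apply: (le_trans _ (ler_norm _)).
have [/= /andP[p1 p2] /andP[q1 q2]] := xr.
rewrite /rect_int /cint /= !mul0r mul1r add0r.
have lb (g : R -> R) : cont_on (- 2) 2 g ->
    (forall t, - 2 <= t <= 2 -> 1 / 18 <= g t) -> 2 / 9 <= rint (- 2) 2 g.
  move=> cg Hg; have -> : 2 / 9 = rint (- 2) 2 (fun=> 1 / 18 : R).
    by rewrite rint_cst; [clear; field|clear; lra].
  by apply: le_rint => //; exact: cont_on_cst.
have cK (u v : R -> R) : cont_on (- 2) 2 (fun t => u t +i* v t : CC R) ->
    (forall t, - 2 <= t <= 2 -> u t +i* v t != p +i* q) ->
    cont_on (- 2) 2 (fun t => (((u t +i* v t) - (p +i* q))^-1 : CC R)).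
  move=> cuv ne t tb.
  apply: (@continuous_comp _ _ _ (fun t => u t +i* v t : CC R)
     (fun z : CC R => (z - (p +i* q : CC R))^-1 : CC R)); first exact: cuv.
  apply: derivable_continuousC; apply: (@derivableCV R (fun z => z - (p +i* q : CC R))).
    apply: (@derivableCD R id (fun=> - (p +i* q : CC R))); first exact: derivable_id.
    exact: derivable_cst.
  by rewrite subr_eq0; exact: ne.
have ch (v : R) : cont_on (- 2) 2 (fun t => t +i* v : CC R).
  by move=> t _; apply: continuousC2; [exact: cvg_id|exact: cvg_cst].
have cv (v : R) : cont_on (- 2) 2 (fun t => v +i* t : CC R).
  by move=> t _; apply: continuousC2; [exact: cvg_cst|exact: cvg_id].
have nh (v : R) : v != q -> forall t, - 2 <= t <= 2 -> t +i* v != p +i* q.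
  by move=> vq t _; rewrite eq_complex /= (negbTE vq) andbF.
have nv (v : R) : v != p -> forall t, - 2 <= t <= 2 -> v +i* t != p +i* q.
  by move=> vq t _; rewrite eq_complex /= (negbTE vq).
have n1 : - 2 != q by rewrite lt_eqF//; clear -q1; lra.
have n2 : 2 != q by rewrite gt_eqF//; clear -q2; lra.
have n3 : - 2 != p by rewrite lt_eqF//; clear -p1; lra.
have n4 : 2 != p by rewrite gt_eqF//; clear -p2; lra.
have oppi (g : R -> R) : cont_on (- 2) 2 g -> - rint (- 2) 2 g = rint (- 2) 2 (fun t => - g t).
  move=> cg; rewrite -[LHS]mulN1r -rintZ//; apply: eq_rint => t _; exact: mulN1r.
have cN (g : R -> R) : cont_on (- 2) 2 g -> cont_on (- 2) 2 (fun t => - g t).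
  by move=> cg t tb; apply: cvgN; exact: cg.
have b3 (s t : R) : - 1 <= s -> s <= 1 -> - 2 <= t <= 2 -> `|t - s| <= 3.
  by clear => h1 h2 /andP[h3 h4]; rewrite ler_norml; apply/andP; split; lra.
have c1 := cK _ _ (ch (- 2)) (nh _ n1).
have c2 := cK _ _ (ch 2) (nh _ n2).
have c3 := cK _ _ (cv (- 2)) (nv _ n3).
have c4 := cK _ _ (cv 2) (nv _ n4).
have I1 := lb _ (cont_on_Im c1).
have I2 := lb _ (cN _ (cont_on_Im c2)).
have I3 := lb _ (cN _ (cont_on_Re c3)).
have I4 := lb _ (cont_on_Re c4).
rewrite -(oppi _ (cont_on_Im c2)) in I2.
rewrite -(oppi _ (cont_on_Re c3)) in I3.
have K1 : forall t, - 2 <= t <= 2 -> 1 / 18 <= complex.Im ((t +i* - 2 - (p +i* q))^-1).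
  move=> t tb /=; rewrite -mulNr opprB opprK.
  rewrite -[(- 2 - q) ^+ 2]sqrrN opprB opprK.
  by apply: inv_kernel_bound; [exact: b3|clear -q1 q2; lra].
have K2 : forall t, - 2 <= t <= 2 -> 1 / 18 <= - complex.Im ((t +i* 2 - (p +i* q))^-1).
  move=> t tb /=; rewrite opprK.
  by apply: inv_kernel_bound; [exact: b3|clear -q1 q2; lra].
have K3 : forall t, - 2 <= t <= 2 -> 1 / 18 <= - complex.Re ((- 2 +i* t - (p +i* q))^-1).
  move=> t tb /=; rewrite -mulNr opprB opprK.
  rewrite -[(- 2 - p) ^+ 2]sqrrN opprB opprK (addrC ((p + 2) ^+ 2)).
  by apply: inv_kernel_bound; [exact: b3|clear -p1 p2; lra].
have K4 : forall t, - 2 <= t <= 2 -> 1 / 18 <= complex.Re ((2 +i* t - (p +i* q))^-1).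
  move=> t tb /=; rewrite (addrC ((2 - p) ^+ 2)).
  by apply: inv_kernel_bound; [exact: b3|clear -p1 p2; lra].
move: (I1 K1) (I2 K2) (I3 K3) (I4 K4).
set A := rint _ _ _; set B := rint _ _ _; set C := rint _ _ _; set D := rint _ _ _.
by clear; lra.
Qed.

(** By Cauchy's formula, and as |z - x| >= 1 on the boundary, |f(x)| (8/9) is at most
    the sum S of the four integrals of |f|.  Cauchy-Schwarz gives S^2 <= 16 sum of the
    integrals of |f|^2, whence the constant 16 (9/8)^2 <= 25. *)
Lemma submean_le f x : (forall z, rect (- 2) 2 (- 2) 2 z -> derivable f z 1) ->
  rect (- 1) 1 (- 1) 1 x ->
  normc (f x) ^+ 2 <=
    25 * \sum_(e < 4) rint (- 2) 2 (fun t => normc (f (side e t)) ^+ 2).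
Proof.
move=> df x1.
have cf e : cont_on (- 2) 2 (fun t => f (side e t)).
  rewrite /side; case: (val e) => [|[|[|n]]];
    (apply: cont_on_hline || apply: cont_on_vline) => t tb;
    apply: derivable_continuousC; apply: df; split => //=; by clear; lra.
have cn e := cont_on_normc (cf e).
set S := fun e => rint (- 2) 2 (fun t => normc (f (side e t))).
have fxS : normc (f x) * (8 / 9) <= \sum_e S e.
  apply: le_trans (ler_wpM2l (normc_ge0 _) (square_winding_bound x1)) _.
  rewrite -normcM -rect_cauchy//; [|case: x1 => ? ?; lra..].
  have ka (z : CC R) : 1 <= `|Re (z - x)| \/ 1 <= `|Im (z - x)| ->
      normc ((z - x)^-1) <= 1 /\ z != x.
    move=> H; have z1 : 1 <= normc (z - x).
      by case: H => H; apply: le_trans H _; [exact: normRe|exact: normIm].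
    have z0 := lt_le_trans ltr01 z1.
    rewrite normcV invf_le1//; split => //.
    by apply: contraTneq z0 => ->; rewrite subrr normc0 ltxx.
  have kside e t : - 2 <= t <= 2 ->
      normc ((side e t - x)^-1) <= 1 /\ side e t != x.
    move=> tb; apply: ka; case: x x1 => p q [/= /andP[p1 p2] /andP[q1 q2]].
    have big (u v : R) : v <= - 1 \/ 1 <= v -> 1 <= `|v|.
      by clear => -[h|h]; rewrite ler_normr; apply/orP; [right|left]; lra.
    rewrite /side; case: (val e) => [|[|[|n]]] /=.
    - by right; apply: big => //; left; clear -q1; lra.
    - by right; apply: big => //; right; clear -q2; lra.
    - by left; apply: big => //; left; clear -p1; lra.
    - by left; apply: big => //; right; clear -p2; lra.
  have le1 e : normc (cint (- 2) 2 (fun t => f (side e t) * (side e t - x)^-1)) <= S e.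
    have ck : cont_on (- 2) 2 (fun t => (side e t - x)^-1 : CC R).
      move=> t tb; apply: (@continuous_comp _ _ _ (side e) (fun z : CC R => (z - x)^-1 : CC R)); first exact: continuous_side.
      apply: derivable_continuousC; apply: (@derivableCV R (fun z => z - x)).
        apply: (@derivableCD R id (fun=> - x)); first exact: derivable_id.
        exact: derivable_cst.
      by rewrite subr_eq0; exact: (kside e t tb).2.
    have cfk := cont_onMC (cf e) ck.
    apply: le_trans (normc_cint_le cfk) _.
    apply: le_rint; [exact: cont_on_normc cfk|exact: cn|move=> t tb].
    by rewrite normcM ler_piMr ?normc_ge0// (kside e t tb).1.
  rewrite /rect_int 4!big_ord_recl big_ord0 addr0.
  have n1 : normc ('i%C : R[i]) = 1 by rewrite /= expr0n expr1n add0r sqrtr1.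
  apply: le_trans (le_normcD _ _) _.
  rewrite normcM n1 mul1r addrA.
  apply: lerD; apply: le_trans (le_normcD _ _) _; rewrite normcN.
    by apply: lerD; [exact: (le1 ord0)|exact: (le1 (lift ord0 ord0))].
  rewrite addrC; apply: lerD; first exact: (le1 (lift ord0 (lift ord0 ord0))).
  exact: (le1 (lift ord0 (lift ord0 (lift ord0 ord0)))).
have S2 e : S e ^+ 2 <= 4 * rint (- 2) 2 (fun t => normc (f (side e t)) ^+ 2).
  apply: le_trans (rint_sqr_le _ (cn e)) _; first by clear; lra.
  by rewrite opprK -natrD.
have S0 e : 0 <= S e by apply: rint_ge0 => t _; exact: normc_ge0.
move: fxS; rewrite 4!big_ord_recl big_ord0 => fxS.
rewrite 4!big_ord_recl big_ord0.
move: (S2 ord0) (S2 (lift ord0 ord0)) (S2 (lift ord0 (lift ord0 ord0))) (S2 (lift ord0 (lift ord0 (lift ord0 ord0)))).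
set r0 := rint _ _ _; set r1 := rint _ _ _; set r2 := rint _ _ _; set r3 := rint _ _ _.
move: fxS (S0 ord0) (S0 (lift ord0 ord0)) (S0 (lift ord0 (lift ord0 ord0))) (S0 (lift ord0 (lift ord0 (lift ord0 ord0)))).
set s0 := S _; set s1 := S _; set s2 := S _; set s3 := S _.
move: (normc_ge0 (f x)); set n := normc _.
clear => n0 H p0 p1 p2 p3 h0 h1 h2 h3.
have H2 : (n * (8 / 9)) ^+ 2 <= (s0 + (s1 + (s2 + (s3 + 0)))) ^+ 2.
  by rewrite ler_sqr ?nnegrE// ?mulr_ge0 ?addr_ge0.
have CS : (s0 + (s1 + (s2 + (s3 + 0)))) ^+ 2 <= 4 * (s0 ^+ 2 + s1 ^+ 2 + s2 ^+ 2 + s3 ^+ 2).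
  rewrite -subr_ge0 (_ : _ - _ = (s0 - s1) ^+ 2 + (s0 - s2) ^+ 2 + (s0 - s3) ^+ 2 +
   (s1 - s2) ^+ 2 + (s1 - s3) ^+ 2 + (s2 - s3) ^+ 2); last by ring.
  by rewrite !addr_ge0 ?sqr_ge0.
rewrite exprMn in H2.
have e0 : 0 <= n ^+ 2 by exact: sqr_ge0.
have e89 : (8 / 9 : R) ^+ 2 = 64 / 81 by field.
rewrite e89 in H2.
lra.
Qed.

End SubMean.

(** * Positive functionals on continuous functions *)

Section PosFunctional.
Context {R : realType}.
Implicit Types (D G : set (CC R)) (phi psi : CC R -> CC R).

Definition cont_in D phi := forall z, D z -> {for z, continuous phi}.

(** A positive linear functional on functions continuous on D, carried by G.
    It stands for integration over finitely many curves, reduced to the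
    properties on which the estimates for Hermitian forms rest. *)
Record pos_functional D G := PosFunctional {
  pf :> (CC R -> CC R) -> CC R;
  pf_linear : forall (k : CC R) phi psi, cont_in D phi -> cont_in D psi ->
    pf (fun z => k * phi z + psi z) = k * pf phi + pf psi;
  pf_conj : forall phi, cont_in D phi ->
    pf (fun z => Num.conj (phi z : R[i])) = Num.conj (pf phi : R[i]);
  pf_ge0 : forall phi, cont_in D phi -> (forall z, G z -> 0 <= (phi z : R[i])) ->
    0 <= (pf phi : R[i]) }.

Section Theory.
Context {D G : set (CC R)} (J : pos_functional D G).

Lemma cont_in_cst (k : CC R) : cont_in D (fun=> k).
Proof. by move=> z _; exact: continuousC_cst. Qed.

Lemma cont_inD phi psi : cont_in D phi -> cont_in D psi ->
  cont_in D (fun z => phi z + psi z : CC R).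
Proof. by move=> c1 c2 z Dz; apply: continuousCD; [exact: c1|exact: c2]. Qed.

Lemma cont_inM phi psi : cont_in D phi -> cont_in D psi ->
  cont_in D (fun z => phi z * psi z : CC R).
Proof. by move=> c1 c2 z Dz; apply: continuousCM; [exact: c1|exact: c2]. Qed.

Lemma cont_inZ (k : CC R) phi : cont_in D phi -> cont_in D (fun z => k * phi z : CC R).
Proof. by move=> c; apply: cont_inM c; exact: cont_in_cst. Qed.

Lemma continuous_conj : continuous (fun z : CC R => (Num.conj (z : R[i])) : CC R).
Proof.
move=> z A /nbhsCP[e e0 eA]; apply/nbhsCP; exists e => // w wz; apply: eA.
rewrite (_ : normc _ = normc (w - z))//.
by case: w z {wz} => [a b] [c d] /=; congr (Num.sqrt _); ring.
Qed.

Lemma cont_in_conj phi : cont_in D phi ->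
  cont_in D (fun z => (Num.conj (phi z : R[i])) : CC R).
Proof.
move=> c z Dz; apply: (@continuous_comp _ _ _ phi
  (fun z : CC R => (Num.conj (z : R[i])) : CC R)); first exact: c.
exact: continuous_conj.
Qed.

Lemma cont_in_sum (I : Type) (r : seq I) (F : I -> CC R -> CC R) :
  (forall i, cont_in D (F i)) -> cont_in D (fun z => \sum_(i <- r) F i z : CC R).
Proof.
move=> c; elim: r => [|i r IH].
  rewrite (_ : (fun _ => _) = (fun=> 0 : CC R)); first exact: cont_in_cst.
  by apply/funext => z; rewrite big_nil.
rewrite (_ : (fun _ => _) = (fun z => F i z + \sum_(i <- r) F i z : CC R)).
  by apply: cont_inD; [exact: c|exact: IH].
by apply/funext => z; rewrite big_cons.
Qed.

Lemma pf0 : J (fun=> 0) = 0.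
Proof.
have := pf_linear J (-1) (@cont_in_cst 0) (@cont_in_cst 0).
rewrite (_ : (fun _ => _) = (fun=> 0)); last first.
  by apply/funext => z; rewrite mulr0 addr0.
by rewrite mulN1r addNr.
Qed.

Lemma pfD phi psi : cont_in D phi -> cont_in D psi ->
  J (fun z => phi z + psi z) = J phi + J psi.
Proof.
move=> c1 c2; have := pf_linear J 1 c1 c2; rewrite mul1r => <-.
by congr (J _); apply/funext => z; rewrite mul1r.
Qed.

Lemma pfZ (k : CC R) phi : cont_in D phi -> J (fun z => k * phi z) = k * J phi.
Proof.
move=> c; have := pf_linear J k c (@cont_in_cst 0); rewrite pf0 addr0 => <-.
by congr (J _); apply/funext => z; rewrite addr0.
Qed.

Lemma pf_sum (I : Type) (r : seq I) (F : I -> CC R -> CC R) :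
  (forall i, cont_in D (F i)) ->
  J (fun z => \sum_(i <- r) F i z) = \sum_(i <- r) J (F i).
Proof.
move=> c; elim: r => [|i r IH].
  by rewrite big_nil -[RHS]pf0; congr (J _); apply/funext => z; rewrite big_nil.
rewrite big_cons -IH -pfD//; last exact: cont_in_sum.
by congr (J _); apply/funext => z; rewrite big_cons.
Qed.

Lemma pf_le phi psi : cont_in D phi -> cont_in D psi ->
  (forall z, G z -> (phi z : R[i]) <= psi z) -> (J phi : R[i]) <= J psi.
Proof.
move=> c1 c2 le12; rewrite -subr_ge0.
have -> : (J psi - J phi : R[i]) = J (fun z => -1 * phi z + psi z).
  by rewrite pf_linear// mulN1r addrC.
apply: pf_ge0; first by apply: cont_inD; [apply: cont_inZ; exact: c1|exact: c2].
by move=> z /le12; rewrite mulN1r addrC subr_ge0.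
Qed.

Lemma pf_eq phi psi : cont_in D phi -> cont_in D psi ->
  (forall z, G z -> phi z = psi z) -> J phi = J psi.
Proof. by move=> c1 c2 e; apply/(@le_anti _ R[i])/andP; split; apply: pf_le => // z /e ->. Qed.

End Theory.

Section BoundaryMean.
Context (s : seq (CC R * R)).

Definition sq_point (u : CC R * R) e (t : R) : CC R := u.1 + (u.2)%:C * side e t.

(** The union of the boundaries of the squares c + rho [-2,2]^2, for (c, rho) in s. *)
Definition sq_points : set (CC R) :=
  [set z | exists u, u \in s /\ exists e t, - 2 <= t <= 2 /\ z = sq_point u e t].

Definition sq_mean phi : CC R :=
  \sum_(u <- s) \sum_(e < 4) cint (- 2) 2 (fun t => phi (sq_point u e t)).

Lemma cont_on_sq_point D phi u e : sq_points `<=` D -> u \in s -> cont_in D phi ->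
  cont_on (- 2) 2 (fun t => phi (sq_point u e t)).
Proof.
move=> sD us cphi t tb.
apply: (@continuous_comp _ _ _ (sq_point u e)); last first.
  by apply/cphi/sD; exists u; split => //; exists e, t.
apply: (@continuous_comp _ _ _ (side e) (fun z : CC R => u.1 + (u.2)%:C * z : CC R)).
  exact: continuous_side.
exact: continuousC_affine.
Qed.

Lemma cint_conj a b (phi : R -> CC R) : cont_on a b phi ->
  cint a b (fun t => Num.conj (phi t : R[i])) = Num.conj (cint a b phi).
Proof.
move=> cphi; have cI := cont_on_Im cphi.
rewrite /cint (_ : Num.conj (_ : R[i]) =
  rint a b (fun t => Re (phi t)) +i* - rint a b (fun t => Im (phi t)))//.
congr (_ +i* _); first by apply: eq_rint => t _; case: (phi t).
rewrite -[RHS]mulN1r -rintZ//; apply: eq_rint => t _.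
by case: (phi t) => p q; rewrite mulN1r.
Qed.

Lemma cint_real a b (g : R -> R) : a <= b ->
  cint a b (fun t => (g t)%:C) = (rint a b g)%:C.
Proof. by move=> ab; rewrite /cint /= rint_cst// mul0r. Qed.

Lemma cint_ge0 a b (phi : R -> CC R) : a <= b ->
  (forall t, a <= t <= b -> 0 <= (phi t : R[i])) -> 0 <= cint a b phi.
Proof.
move=> ab H; rewrite /cint lecE /=; apply/andP; split.
  rewrite (@eq_rint _ _ _ _ (fun=> 0)) ?rint_cst ?mul0r// => t /H.
  by rewrite lecE /= => /andP[/eqP].
by apply: rint_ge0 => t /H; rewrite lecE /= => /andP[].
Qed.

Lemma sq_mean_linear D (sD : sq_points `<=` D) (k : CC R) phi psi :
  cont_in D phi -> cont_in D psi ->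
  sq_mean (fun z => k * phi z + psi z) = k * sq_mean phi + sq_mean psi.
Proof.
move=> c1 c2; rewrite /sq_mean mulr_sumr -big_split /= big_seq [RHS]big_seq.
apply: eq_bigr => u us; rewrite mulr_sumr -big_split /=; apply: eq_bigr => e _.
have d1 := cont_on_sq_point (e:=e) sD us c1; have d2 := cont_on_sq_point (e:=e) sD us c2.
rewrite cintD; [|by apply: cont_onMC; [exact: cont_on_cst|exact: d1]|exact: d2].
by rewrite cintZ; [|exact: d1].
Qed.

Lemma sq_mean_conj D (sD : sq_points `<=` D) phi : cont_in D phi ->
  sq_mean (fun z => Num.conj (phi z : R[i])) = Num.conj (sq_mean phi : R[i]).
Proof.
move=> c1; rewrite /sq_mean rmorph_sum big_seq [RHS]big_seq; apply: eq_bigr => u us.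
rewrite rmorph_sum; apply: eq_bigr => e _; apply: cint_conj.
exact: cont_on_sq_point sD us c1.
Qed.

Lemma sq_mean_ge0 phi : (forall z, sq_points z -> 0 <= (phi z : R[i])) ->
  0 <= (sq_mean phi : R[i]).
Proof.
move=> H; rewrite /sq_mean big_seq; apply: sumr_ge0 => u us; apply: sumr_ge0 => e _.
apply: cint_ge0; first by lra.
by move=> t tb; apply: H; exists u; split => //; exists e, t.
Qed.

Definition sq_functional D (sD : sq_points `<=` D) : pos_functional D sq_points :=
  PosFunctional (sq_mean_linear sD) (sq_mean_conj sD)
    (fun phi _ H => sq_mean_ge0 H).

(** The inequality for the one square containing the point, transported by
    z |-> c + rho z; the other squares contribute nonnegative terms. *)
Lemma sq_mean_submean (f : CC R -> CC R) u x : u \in s -> 0 < u.2 ->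
  (forall z, rect (- 2) 2 (- 2) 2 z -> derivable f (u.1 + (u.2)%:C * z) 1) ->
  rect (- 1) 1 (- 1) 1 x ->
  `|f (u.1 + (u.2)%:C * x) : R[i]| ^+ 2 <= 25 * (sq_mean (fun z => `|f z : R[i]| ^+ 2) : R[i]).
Proof.
move=> us u0 df x1.
pose g (z : CC R) := f (u.1 + (u.2)%:C * z).
have dg z : rect (- 2) 2 (- 2) 2 z -> derivable g z 1.
  move=> /df dfz; apply: (@derivableC_comp R (fun z => u.1 + (u.2)%:C * z) f z _ dfz).
  apply: (@derivableCD R (fun=> u.1) (fun z => (u.2)%:C * z)).
    exact: derivable_cst.
  apply: (@derivableCM R (fun=> (u.2)%:C) id); first exact: derivable_cst.
  exact: derivable_id.
have := submean_le dg x1.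
rewrite -lecR normc_normE -rmorphXn => /le_trans; apply.
rewrite rmorphM rmorph_nat ler_pM2l// rmorph_sum /sq_mean (big_rem u)//=.
rewrite -[leLHS]addr0; apply: lerD.
  apply: ler_sum => e _; rewrite le_eqVlt -cint_real; last by lra.
  apply/orP; left; apply/eqP; apply: eq_cint => t _.
  by rewrite /g normc_normE -rmorphXn.
apply: sumr_ge0 => v _; apply: sumr_ge0 => e _; apply: cint_ge0; first by lra.
by move=> t _; rewrite exprn_ge0.
Qed.

End BoundaryMean.

End PosFunctional.

(** * The trace bound on an invariant space of vector-valued functions *)

Section Forms.
Context {R : realType} {N : nat}.
Notation V := (CC R -> 'cV[R[i]]_N).
Implicit Types (D G : set (CC R)) (F : V).

Definition coord F a : CC R -> CC R := fun z => F z a ord0.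

Definition holomorphic_vec D F := forall a, holomorphic_on D (coord F a).

Definition lincomb n (b : 'I_n -> V) (u : 'rV[R[i]]_n) : V := \sum_i u 0 i *: b i.

Definition form D G (J : pos_functional D G) F F' : R[i] :=
  J (fun z => \sum_a F z a ord0 * Num.conj (F' z a ord0)).

Definition gram D G (J : pos_functional D G) n (b : 'I_n -> V) : 'M[R[i]]_n :=
  \matrix_(i, j) form J (b i) (b j).

Lemma lincombE n (b : 'I_n -> V) u z a :
  lincomb b u z a ord0 = \sum_i u 0 i * b i z a ord0.
Proof.
rewrite /lincomb fct_sumE summxE; apply: eq_bigr => i _.
by rewrite [LHS]mxE.
Qed.

Section OneForm.
Context {D G : set (CC R)} (J : pos_functional D G).

Lemma holomorphic_cont F a : holomorphic_vec D F -> cont_in D (coord F a).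
Proof. by move=> hF z Dz; apply: derivable_continuousC; exact: hF. Qed.

Lemma cont_prod F F' : holomorphic_vec D F -> holomorphic_vec D F' ->
  cont_in D (fun z => \sum_a F z a ord0 * Num.conj (F' z a ord0) : CC R).
Proof.
move=> hF hF'; apply: (@cont_in_sum R D _ _ (fun a z => F z a ord0 * Num.conj (F' z a ord0))) => a.
apply: (@cont_inM R D (coord F a) (fun z => Num.conj (coord F' a z : R[i]))).
  exact: holomorphic_cont.
apply: cont_in_conj; exact: holomorphic_cont.
Qed.

Lemma form_conj F F' : holomorphic_vec D F -> holomorphic_vec D F' ->
  form J F F' = Num.conj (form J F' F).
Proof.
move=> hF hF'; rewrite /form -pf_conj; last exact: cont_prod.
congr (J _); apply/funext => z; rewrite rmorph_sum; apply: eq_bigr => a _.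
by rewrite rmorphM /= conjCK mulrC.
Qed.

Lemma form_lincomb n (b : 'I_n -> V) u v : (forall i, holomorphic_vec D (b i)) ->
  form J (lincomb b u) (lincomb b v) = (u *m gram J b *m v^t*) 0 0.
Proof.
move=> hb.
have cp i j := cont_prod (hb i) (hb j).
rewrite /form (_ : (fun z => _) = (fun z => \sum_i \sum_j (u 0 i * Num.conj (v 0 j)) *
   \sum_a b i z a ord0 * Num.conj (b j z a ord0) : CC R)); last first.
  apply/funext => z.
  transitivity (\sum_a \sum_i \sum_j (u 0 i * Num.conj (v 0 j)) *
     (b i z a ord0 * Num.conj (b j z a ord0))).
    apply: eq_bigr => a _; rewrite !lincombE mulr_suml; apply: eq_bigr => i _.
    rewrite rmorph_sum mulr_sumr; apply: eq_bigr => j _.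
    by rewrite rmorphM /= mulrACA.
  rewrite exchange_big; apply: eq_bigr => i _.
  rewrite exchange_big; apply: eq_bigr => j _.
  by rewrite mulr_sumr.
rewrite pf_sum => [|i]; last first.
  by apply: cont_in_sum => j; apply: cont_inZ; exact: cp.
rewrite mxE.
under [RHS]eq_bigr => j _ do rewrite mxE mulr_suml.
rewrite [RHS]exchange_big; apply: eq_bigr => i _.
rewrite pf_sum => [|j]; last by apply: cont_inZ; exact: cp.
apply: eq_bigr => j _; rewrite pfZ; last exact: cp.
by rewrite !mxE mulrAC.
Qed.

Lemma holomorphic_lincomb n (b : 'I_n -> V) u : (forall i, holomorphic_vec D (b i)) ->
  holomorphic_vec D (lincomb b u).
Proof.
move=> hb a z Dz.
rewrite (_ : coord _ a = \sum_i (fun z => u 0 i * coord (b i) a z : CC R)); last first.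
  by apply/funext => w; rewrite /coord lincombE fct_sumE.
apply: derivable_sum => i; apply: (@derivableCM R (fun=> u 0 i)).
  exact: derivable_cst.
exact: hb.
Qed.

Lemma form_sqE F : holomorphic_vec D F ->
  form J F F = \sum_a J (fun z => `|F z a ord0| ^+ 2 : CC R).
Proof.
move=> hF; rewrite -pf_sum => [|a]; last first.
  rewrite (_ : (fun z => _) = (fun z => coord F a z * Num.conj (coord F a z : R[i]) : CC R)).
    apply: cont_inM; [|apply: cont_in_conj]; exact: holomorphic_cont.
  by apply/funext => z; rewrite normCK.
rewrite /form; congr (J _); apply/funext => z; apply: eq_bigr => a _.
by rewrite normCK.
Qed.

Lemma cont_sqr F a : holomorphic_vec D F -> cont_in D (fun z => `|F z a ord0| ^+ 2 : CC R).
Proof.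
move=> hF; rewrite (_ : (fun z => _) = (fun z => coord F a z * Num.conj (coord F a z : R[i]) : CC R)).
  apply: cont_inM; [|apply: cont_in_conj]; exact: holomorphic_cont.
by apply/funext => z; rewrite normCK.
Qed.

Definition evaluation_bounded (kappa : R[i]) (K : set (CC R)) :=
  forall f, holomorphic_on D f -> forall x, K x ->
    `|f x : R[i]| ^+ 2 <= kappa * (J (fun z => `|f z : R[i]| ^+ 2 : CC R) : R[i]).

(** Apply the bounded evaluation to F = sum_i conj(e_i(x)_a) e_i, the representer of
    the evaluation F |-> F(x)_a: its value at x and its squared norm are both equal to
    the sum tau to be estimated, so that tau^2 <= kappa tau. *)
Lemma orthonormal_evaluation kappa K n (b : 'I_n -> V) m (S : 'M[R[i]]_(m, n)) x a :
  0 <= kappa -> evaluation_bounded kappa K -> (forall i, holomorphic_vec D (b i)) ->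
  S *m gram J b *m S^t* = 1%:M -> K x ->
  \sum_i `|lincomb b (row i S) x a ord0| ^+ 2 <= kappa.
Proof.
move=> k0 ev hb Sb Kx.
pose w : 'cV[R[i]]_m := \col_i lincomb b (row i S) x a ord0.
pose u := w^t* *m S.
set tau := \sum_i _.
have tau0 : 0 <= tau by apply: sumr_ge0 => i _; rewrite exprn_ge0.
have ww : (w^t* *m w) 0 0 = tau.
  rewrite mxE; apply: eq_bigr => i _; rewrite !mxE normCK mulrC.
  by [].
have fx : lincomb b u x a ord0 = tau.
  rewrite -ww lincombE mxE.
  transitivity (\sum_j \sum_i (w^t*) 0 i * S i j * b j x a ord0).
    by apply: eq_bigr => j _; rewrite mxE mulr_suml.
  rewrite exchange_big; apply: eq_bigr => i _; rewrite [w i 0]mxE lincombE mulr_sumr.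
  by apply: eq_bigr => j _; rewrite !mxE mulrA.
have ff : form J (lincomb b u) (lincomb b u) = tau.
  rewrite form_lincomb// -ww /u trmx_mul map_mxM trmxCK !mulmxA.
  by rewrite -(mulmxA _ S) -(mulmxA _ (S *m _)) Sb mulmx1.
have hu : holomorphic_vec D (lincomb b u) by exact: holomorphic_lincomb.
have := ev _ (hu a) x Kx; rewrite /coord fx ger0_norm// => H.
have : tau ^+ 2 <= kappa * tau.
  apply: le_trans H _; apply: ler_wpM2l => //.
  rewrite -[leRHS]ff form_sqE// (bigD1 a)//= lerDl.
  apply: sumr_ge0 => i _; apply: pf_ge0; first exact: cont_sqr.
  by move=> z _; rewrite exprn_ge0.
move: tau0; rewrite le_eqVlt => /predU1P[<-//|tau0].
by rewrite expr2 ler_pM2r.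
Qed.

End OneForm.

Lemma sqr_sum_le d (x : 'I_d -> R[i]) :
  `|\sum_l x l| ^+ 2 <= d%:R * \sum_l `|x l| ^+ 2.
Proof.
apply: (@le_trans _ _ ((\sum_l `|x l|) ^+ 2)).
  by rewrite lerXn2r ?nnegrE ?sumr_ge0// ler_norm_sum.
rewrite -(ler_pMn2r (n := 2))//.
rewrite expr2 mulr_suml -sumrMnl.
rewrite [leRHS](_ : _ = \sum_l \sum_k (`|x l| ^+ 2 + `|x k| ^+ 2)); last first.
  under [RHS]eq_bigr => l _ do rewrite big_split sumr_const card_ord /=.
  by rewrite big_split /= sumr_const card_ord sumrMnl mulr_natl mulr2n.
apply: ler_sum => l _; rewrite mulr_sumr -sumrMnl; apply: ler_sum => k _.
have /real_exprn_even_ge0 : `|x l| - `|x k| \is Num.real.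
  by rewrite realB// normr_real.
by move=> /(_ 2%N isT); rewrite sqrrB addrAC subr_ge0.
Qed.

(** The operator is known only through its matrix A in the basis b and through its
    formula as a weighted sum of compositions.  J1 and J2 define the inner and
    the outer norm. *)
Theorem eigenvalue_bound (D K G1 G2 : set (CC R)) (J1 : pos_functional D G1)
    (J2 : pos_functional D G2) (kappa B : R[i]) (d : nat)
    (w : 'I_d -> CC R -> R[i]) (gam : 'I_d -> CC R -> CC R) (pi : 'I_d -> 'I_N -> 'I_N)
    n (b : 'I_n -> V) (A : 'M[R[i]]_n) (delta : R[i]) :
  0 <= kappa -> 0 <= B -> 0 < delta -> G1 `<=` D -> G2 `<=` D ->
  evaluation_bounded J1 kappa K -> evaluation_bounded J2 kappa G1 ->
  (forall l z, D z -> K (gam l z)) -> (forall l z, D z -> `|w l z| <= B) ->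
  (forall i, holomorphic_vec D (b i)) -> (forall i z, ~ D z -> b i z = 0) ->
  (forall u, lincomb b u = 0 -> u = 0) ->
  (forall i z a, D z -> lincomb b (row i A) z a ord0 =
     \sum_l w l z * b i (gam l z) (pi l a) ord0) ->
  (forall a, eigenvalue A a -> delta <= `|a|) ->
  delta * n%:R *+ 2 <= N%:R * kappa * (J1 (fun=> 1) + d%:R ^+ 2 * B ^+ 2 * J2 (fun=> 1)).
Proof.
move=> k0 B0 delta0 G1D G2D ev1 ev2 gamK wB hb b0 bfree HA Adelta.
have hl u : holomorphic_vec D (lincomb b u) by exact: holomorphic_lincomb.
have HAu u z a : D z -> lincomb b (u *m A) z a ord0 =
    \sum_l w l z * lincomb b u (gam l z) (pi l a) ord0.
  move=> Dz; rewrite lincombE.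
  transitivity (\sum_i u 0 i * lincomb b (row i A) z a ord0).
    under [RHS]eq_bigr => i _ do rewrite lincombE mulr_sumr.
    rewrite [RHS]exchange_big; apply: eq_bigr => j _; rewrite mxE mulr_suml.
    by apply: eq_bigr => i _; rewrite !mxE mulrA.
  under eq_bigr => i _ do rewrite HA// mulr_sumr.
  rewrite exchange_big; apply: eq_bigr => l _; rewrite lincombE mulr_sumr.
  by apply: eq_bigr => i _; rewrite mulrCA.
have A_inj (u : 'rV[R[i]]_n) : u *m A = 0 -> u = 0.
  move=> uA; apply/eqP; apply: contraT => u0.
  have /Adelta : eigenvalue A 0 by apply/eigenvalueP; exists u; rewrite // uA scale0r.
  by rewrite normr0 => /(lt_le_trans delta0); rewrite ltxx.
have sq_ge0 D' G' (J : pos_functional D' G') F a : holomorphic_vec D' F ->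
    0 <= (J (fun z => `|F z a ord0| ^+ 2 : CC R) : R[i]).
  by move=> hF; apply: pf_ge0; [exact: cont_sqr|move=> z _; rewrite exprn_ge0].
have form_ge0 D' G' (J : pos_functional D' G') F : holomorphic_vec D' F -> 0 <= form J F F.
  by move=> hF; rewrite form_sqE//; apply: sumr_ge0 => a _; exact: sq_ge0.
have form0 D' G' (J : pos_functional D' G') F K' : holomorphic_vec D' F ->
    evaluation_bounded J kappa K' -> form J F F = 0 ->
    forall x a, K' x -> F x a ord0 = 0.
  move=> hF ev; rewrite form_sqE// => /eqP; rewrite psumr_eq0 => [/allP F0 x a K'x|a _]; last exact: sq_ge0.
  have /eqP Fa0 := F0 a (mem_index_enum a).
  have := ev _ (hF a) x K'x; rewrite /coord Fa0 mulr0.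
  move=> F2; apply/eqP; rewrite -normr_eq0 -sqrf_eq0 eq_le [_ <= _]F2 exprn_ge0//.
(* A combination with zero inner norm vanishes on K, hence so does its image by
   the operator everywhere, and A is injective. *)
have zero1 u : form J1 (lincomb b u) (lincomb b u) = 0 -> u = 0.
  move=> /(form0 _ _ _ _ _ (hl u) ev1) H.
  apply/A_inj/bfree/funext => z; apply/colP => a; rewrite [RHS]mxE.
  have [Dz|nDz] := pselect (D z); last first.
    by rewrite lincombE big1// => i _; rewrite b0// [X in _ * X]mxE mulr0.
  by rewrite HAu// big1// => l _; rewrite (H _ _ (gamK l z Dz)) mulr0.
(* Zero outer norm implies vanishing on G1, hence zero inner norm. *)
have zero2 u : form J2 (lincomb b u) (lincomb b u) = 0 -> u = 0.
  move=> /(form0 _ _ _ _ _ (hl u) ev2) H; apply: zero1.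
  rewrite form_sqE// big1// => a _.
  rewrite -[RHS](pf0 J1); apply: pf_eq; [exact: cont_sqr|exact: cont_in_cst|].
  by move=> z G1z; rewrite H// normr0 expr0n.
have pos D' G' (J : pos_functional D' G') : (forall i, holomorphic_vec D' (b i)) ->
    (forall u, form J (lincomb b u) (lincomb b u) = 0 -> u = 0) -> posdefmx (gram J b).
  move=> hb' zero; split.
    by apply/matrixP => i j; rewrite !mxE -form_conj.
  move=> u u0; rewrite -form_lincomb// lt_neqAle form_ge0 ?andbT; last exact: holomorphic_lincomb.
  by rewrite eq_sym; apply: contraNneq u0 => /zero ->.
have trE D' G' (J : pos_functional D' G') (S : 'M[R[i]]_n) : (forall i, holomorphic_vec D' (b i)) ->
    \tr (S *m gram J b *m S^t*) =
    J (fun z => \sum_i \sum_a `|lincomb b (row i S) z a ord0| ^+ 2).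
  move=> hb'; rewrite pf_sum => [|i]; last first.
    by apply: cont_in_sum => a; apply: cont_sqr; exact: holomorphic_lincomb.
  apply: eq_bigr => i _; rewrite pf_sum => [|a]; last first.
    by apply: cont_sqr; exact: holomorphic_lincomb.
  rewrite -form_sqE; last exact: holomorphic_lincomb.
  rewrite form_lincomb// -row_mul !mxE; apply: eq_bigr => k _.
  by rewrite !mxE.
have csum D' (S : 'M[R[i]]_n) : (forall i, holomorphic_vec D' (b i)) ->
    cont_in D' (fun z => \sum_i \sum_a `|lincomb b (row i S) z a ord0| ^+ 2 : CC R).
  move=> hb'; apply: cont_in_sum => i; apply: cont_in_sum => a; apply: cont_sqr.
  exact: holomorphic_lincomb.
rewrite mulrDr; apply: (@eigenvalue_count_le _ _ A (gram J2 b) (gram J1 b)) => //.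
- exact: pos.
- exact: pos.
- move=> S SP; rewrite trE//.
  rewrite -pfZ; last exact: cont_in_cst.
  apply: pf_le; [exact: csum|by apply: cont_inZ; exact: cont_in_cst|move=> z G1z].
  rewrite [leRHS](_ : _ = \sum_(a < N) kappa); last first.
    by rewrite [LHS]mulr1 sumr_const card_ord mulr_natl.
  rewrite exchange_big /=.
  by apply: ler_sum => a _; apply: (orthonormal_evaluation (J := J2)) SP G1z.
- move=> S SM; rewrite trE//.
  rewrite mulrA -pfZ; last exact: cont_in_cst.
  apply: pf_le; [exact: csum|by apply: cont_inZ; exact: cont_in_cst|move=> z G2z].
  have Dz := G2D _ G2z.
  rewrite [leRHS](_ : _ = \sum_(a < N) kappa * (d%:R ^+ 2 * B ^+ 2)); last first.
    by rewrite [LHS]mulr1 sumr_const card_ord -mulrA mulr_natl.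
  rewrite exchange_big /=.
  apply: ler_sum => a _.
  apply: (@le_trans _ _ (\sum_i d%:R * \sum_l B ^+ 2 *
     `|lincomb b (row i S) (gam l z) (pi l a) ord0| ^+ 2)).
    apply: ler_sum => i _; rewrite row_mul HAu//; apply: le_trans (sqr_sum_le _) _.
    apply: ler_wpM2l => //; apply: ler_sum => l _; rewrite normrM exprMn.
    by apply: ler_wpM2r; rewrite ?exprn_ge0// lerXn2r ?nnegrE ?wB.
  rewrite -mulr_sumr exchange_big /=.
  apply: (@le_trans _ _ (d%:R * \sum_(l < d) B ^+ 2 * kappa)).
    apply: ler_wpM2l => //; apply: ler_sum => l _; rewrite -mulr_sumr.
    apply: ler_wpM2l; first by rewrite exprn_ge0.
    by apply: (orthonormal_evaluation (J := J1)) SM (gamK l z Dz).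
  rewrite sumr_const card_ord -(mulr_natl (B ^+ 2 * kappa)) [leLHS](_ : _ = kappa * (d%:R ^+ 2 * B ^+ 2))//.
  by ring.
Qed.

End Forms.

(** * Squares around a compact set *)

Section Geometry.
Context {R : realType}.
Implicit Types (A K D : set (CC R)).

Lemma bounded_normc A : bounded_set A -> exists B : R, forall z, A z -> normc z <= B.
Proof.
move=> [M [Mr HM]]; exists (Re M + 1) => z Az.
have : M < (Re M + 1)%:C by rewrite -{1}(RRe_real Mr) ltcR ltrDl.
move=> /HM /(_ _ Az) zM.
by have : (normc z)%:C <= (Re M + 1)%:C by []; rewrite lecR.
Qed.

Lemma closed_bounded_compact A (B : R) : closed A ->
  (forall z, A z -> normc z <= B) -> compact A.
Proof.
move=> cA AB; pose h (p : R * R) : CC R := p.1 +i* p.2.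
have ch : continuous h.
  by move=> p; apply: continuousC2; [exact: cvg_fst|exact: cvg_snd].
have cQ : compact (h @` (`[- B, B] `*` `[- B, B])).
  apply: continuous_compact; first exact: continuous_subspaceT.
  by apply: compact_setX; exact: segment_compact.
apply: subclosed_compact cA cQ _ => z Az.
exists (Re z, Im z); last by rewrite /h; case: (z).
have := AB _ Az; split => /=; rewrite in_itv /= -ler_norml;
  by [exact: le_trans (normRe z) _|exact: le_trans (normIm z) _].
Qed.

Lemma normc_rect (r : R) (z : CC R) : rect (- r) r (- r) r z -> normc z <= 2 * r.
Proof.
move=> [h1 h2]; apply: le_trans (normc_leD _) _.
by rewrite mulrDl mul1r lerD// ler_norml.
Qed.

Lemma rect_normc (r : R) (z : CC R) : normc z <= r -> rect (- r) r (- r) r z.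
Proof.
move=> zr; split; rewrite -ler_norml.
  exact: le_trans (normRe z) zr.
exact: le_trans (normIm z) zr.
Qed.

(** A finite subcover of the discs of radius r_x around the points x of K, where the
    disc of radius 10 r_x lies in D: it contains the square of half-side 4 r_x. *)
Lemma bounding_squares K D : compact K -> open D -> K `<=` D ->
  exists s : seq (CC R * R),
    (forall u, u \in s -> 0 < u.2 /\
       forall z, rect (- 4) 4 (- 4) 4 z -> D (u.1 + (u.2)%:C * z)) /\
    (forall x, K x -> exists2 u, u \in s &
       exists2 y, rect (- 1) 1 (- 1) 1 y & x = u.1 + (u.2)%:C * y).
Proof.
move=> cK oD KD.
have H x : exists r : R, K x -> 0 < r /\ forall w, normc (w - x) < 10 * r -> D w.
  have [Kx|] := pselect (K x); last by exists 0.
  have /nbhsCP[e e0 He] : nbhs x D by apply: open_nbhs_nbhs; split; [|exact: KD].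
  exists (e / 10) => _; split; first by rewrite divr_gt0.
  by move=> w; rewrite mulrC divfK//; exact: He.
have [r Hr] := choice H.
move: cK; rewrite compact_cover => cK.
have [||E EK KE] := cK (CC R) K (fun x => [set w | normc (w - x) < r x]).
- move=> x Kx; rewrite openE => w /= wx; apply/nbhsCP.
  exists (r x - normc (w - x)); first by rewrite subr_gt0.
  move=> v vw /=; rewrite -(subrKA w) ; apply: le_lt_trans (le_normcD _ _) _.
  by rewrite -ltrBrDr.
- by move=> x Kx; exists x => //=; rewrite subrr normc0; case: (Hr x Kx).
exists [seq (x, r x) | x <- finmap.enum_fset E]; split.
  move=> u /mapP[x xE ->] /=.
  have Kx : K x by have := EK x xE; rewrite inE.
  have [r0 Dw] := Hr x Kx; split=> // z /normc_rect zr; apply: Dw.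
  rewrite addrAC subrr add0r normcM normc_real gtr0_norm//.
  apply: le_lt_trans (ler_wpM2l (ltW r0) zr) _.
  by clear -r0; lra.
move=> x /KE[c cE /= xc]; exists (c, r c); first by apply/mapP; exists c.
have Kc : K c by have := EK c cE; rewrite inE.
have [r0 _] := Hr c Kc.
have rc0 : (r c)%:C != 0 :> R[i] by rewrite eq_complex /= eqxx andbT lt0r_neq0.
exists ((r c)%:C^-1 * (x - c)).
  apply: rect_normc; rewrite normcM normcV normc_real gtr0_norm//.
  by rewrite mulrC ler_pdivrMr// mul1r ltW.
by rewrite /= mulrA mulfV// mul1r addrC subrK.
Qed.

Lemma rectZ (r k : R) (z : CC R) : 0 <= k -> rect (- r) r (- r) r z ->
  rect (- (k * r)) (k * r) (- (k * r)) (k * r) (k%:C * z).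
Proof.
move=> k0; rewrite /rect /= -!ler_norml => -[h1 h2].
case: z h1 h2 => u v /= h1 h2; rewrite !mul0r subr0 addr0 !normrM (ger0_norm k0).
by split; apply: ler_wpM2l.
Qed.

Definition doubled (s : seq (CC R * R)) := [seq (u.1, 2 * u.2) | u <- s].

Section Squares.
Context (D : set (CC R)) (s : seq (CC R * R)).
Hypothesis sD : forall u, u \in s -> 0 < u.2 /\
  forall z, rect (- 4) 4 (- 4) 4 z -> D (u.1 + (u.2)%:C * z).

Lemma realCM (x y : R) : (x * y)%:C = x%:C * y%:C :> R[i].
Proof. exact: rmorphM. Qed.

Lemma squares_sub : sq_points s `<=` D.
Proof.
move=> _ [u [us [e [t [tb ->]]]]]; have [_] := sD us; apply.
by apply: sub_rect (side_rect e tb); lra.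
Qed.

Lemma doubled_squares_sub : sq_points (doubled s) `<=` D.
Proof.
move=> _ [_ [/mapP[u us ->] [e [t [tb ->]]]]]; have [_ H] := sD us.
rewrite /sq_point /= (mulrC 2) realCM -mulrA; apply: H.
have := rectZ (k := 2) _ (side_rect e tb).
by rewrite (_ : 2 * 2 = 4); [apply|ring].
Qed.

Definition inner_functional := sq_functional squares_sub.
Definition outer_functional := sq_functional doubled_squares_sub.

(** The covering squares of half-side rho lie inside those of half-side 2 rho, on
    whose boundaries the inner functional integrates. *)
Lemma inner_evaluation K :
  (forall x, K x -> exists2 u, u \in s &
     exists2 y, rect (- 1) 1 (- 1) 1 y & x = u.1 + (u.2)%:C * y) ->
  evaluation_bounded inner_functional 25 K.
Proof.
move=> sK f hf x /sK[u us [y y1 ->]].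
have [u0 uD] := sD us; apply: sq_mean_submean => // z z2.
apply/hf/uD; apply: sub_rect z2; lra.
Qed.

(** The boundary of the square of half-side 2 rho lies inside the square of
    half-side 4 rho. *)
Lemma outer_evaluation : evaluation_bounded outer_functional 25 (sq_points s).
Proof.
move=> f hf x [u [us [e [t [tb ->]]]]].
have [u0 uD] := sD us.
have ds : (u.1, 2 * u.2) \in doubled s by apply/mapP; exists u.
have E (z : CC R) : u.1 + (2 * u.2)%:C * z = u.1 + (u.2)%:C * (2%:C * z).
  by rewrite (mulrC 2) realCM mulrA.
have r1 : rect (- 1) 1 (- 1) 1 ((1 / 2)%:C * side e t : CC R).
  have := rectZ (k := 1 / 2) _ (side_rect e tb).
  by rewrite (_ : 1 / 2 * 2 = 1 :> R); [apply; lra|field].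
have -> : sq_point u e t = u.1 + (2 * u.2)%:C * ((1 / 2)%:C * side e t).
  rewrite E [2%:C * _]mulrA -realCM (_ : 2 * (1 / 2) = 1 :> R); last by field.
  by rewrite mul1r.
apply: (sq_mean_submean (s := doubled s) (u := (u.1, 2 * u.2))) => //=.
  by rewrite mulr_gt0.
move=> z z2; rewrite E; apply/hf/uD.
have := rectZ (k := 2) _ z2.
by rewrite (_ : 2 * 2 = 4 :> R); [apply|ring].
Qed.

End Squares.

End Geometry.

(** * Sums of generalized eigenspaces *)

Section GeneralizedEigenspaces.
Context {K : numFieldType} {V : lmodType K}.
Implicit Types (W H : set V) (v w : V).

Definition subspace W := W 0 /\ forall (a : K) v w, W v -> W w -> W (a *: v + w).

Lemma has_dimension_subspace W n : has_dimension W n -> subspace W.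
Proof.
move=> [b [_ Wb]]; split.
  by apply/Wb; exists (fun=> 0); rewrite big1// => i _; rewrite scale0r.
move=> a v w /Wb[x ->] /Wb[y ->]; apply/Wb; exists (fun i => a * x i + y i).
by rewrite scaler_sumr -big_split; apply: eq_bigr => i _; rewrite scalerDl scalerA.
Qed.

Lemma has_dimension_add W1 W2 m n : has_dimension W1 m -> has_dimension W2 n ->
  (forall v w, W1 v -> W2 w -> v + w = 0 -> v = 0 /\ w = 0) ->
  has_dimension [set v | exists v1 v2, [/\ W1 v1, W2 v2 & v = v1 + v2]] (m + n).
Proof.
move=> [b1 [free1 W1b]] [b2 [free2 W2b]] W12.
pose b (i : 'I_(m + n)) := match fintype.split i with inl j => b1 j | inr k => b2 k end.
have bsum (a : 'I_(m + n) -> K) : \sum_i a i *: b i =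
    \sum_j a (lshift n j) *: b1 j + \sum_k a (rshift m k) *: b2 k.
  rewrite big_split_ord; congr (_ + _); apply: eq_bigr => j _; congr (_ *: _).
    by rewrite /b (unsplitK (inl j)).
  by rewrite /b (unsplitK (inr j)).
exists b; split=> [a|v].
  rewrite bsum => /W12[||e1 e2].
  - by apply/W1b; exists (fun j => a (lshift n j)).
  - by apply/W2b; exists (fun j => a (rshift m j)).
  move=> i; rewrite -(fintype.splitK i); case: (fintype.split i) => j /=.
    exact: (free1 (fun j => a (lshift n j))).
  exact: (free2 (fun j => a (rshift m j))).
split=> [[v1 [v2 [/W1b[x1 ->] /W2b[x2 ->] ->]]]|[a ->]].
  exists (fun i => match fintype.split i with inl j => x1 j | inr k => x2 k end).
  rewrite bsum; congr (_ + _); apply: eq_bigr => j _; congr (_ *: _).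
    by rewrite (unsplitK (inl j)).
  by rewrite (unsplitK (inr j)).
rewrite bsum; eexists; eexists; split; last reflexivity.
- by apply/W1b; exists (fun j => a (lshift n j)).
- by apply/W2b; exists (fun j => a (rshift m j)).
Qed.

Context (H : set V) (L : V -> V).
Hypothesis L_linear : forall a v w, L (a *: v + w) = a *: L v + L w.
Hypothesis L_stable : forall v, H v -> H (L v).

Local Notation T mu := (fun w => L w - mu *: w).
Local Notation E := (gen_eigenspace H L).

Lemma operator0 : L 0 = 0.
Proof. by have := L_linear (-1) 0 0; rewrite scaler0 addr0 scaleN1r addNr. Qed.

Lemma shifted_linear mu a v w : T mu (a *: v + w) = a *: T mu v + T mu w.
Proof.
rewrite /= L_linear scalerDr !scalerA mulrC scalerBr scalerA opprD.
by rewrite (mulrC a) addrACA.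
Qed.

Lemma iter_shifted_linear mu k a v w :
  iter k (T mu) (a *: v + w) = a *: iter k (T mu) v + iter k (T mu) w.
Proof. by elim: k => //= k ->; exact: shifted_linear. Qed.

Lemma iter_shifted0 mu k : iter k (T mu) 0 = 0.
Proof. by elim: k => //= k ->; rewrite operator0 scaler0 subr0. Qed.

Lemma iter_shifted_comm mu k v : iter k (T mu) (L v) = L (iter k (T mu) v).
Proof.
elim: k => //= k ->; set x := iter k _ v.
rewrite [in RHS](_ : L x - mu *: x = - mu *: x + L x); last by rewrite scaleNr addrC.
by rewrite L_linear scaleNr addrC.
Qed.

Lemma gen_eigenspace_stable mu v : E mu v -> E mu (L v).
Proof.
move=> [Hv [k vk]]; split; first exact: L_stable.
by exists k; rewrite iter_shifted_comm vk operator0.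
Qed.

Lemma gen_eigenspace_shift mu nu v : subspace (E mu) -> E mu v -> E mu (T nu v).
Proof.
move=> [_ sE] Ev; rewrite /= addrC -scaleNr; apply: sE => //.
exact: gen_eigenspace_stable.
Qed.

(** On a vector with L v = nu v, the operator L - mu acts as the nonzero scalar nu - mu. *)
Lemma gen_eigenspace_shift_inj mu nu v : nu != mu -> E mu v -> T nu v = 0 -> v = 0.
Proof.
move=> numu [_ [k]] vk /eqP; rewrite subr_eq0 => /eqP Lv.
have vE j : iter j (T mu) v = (nu - mu) ^+ j *: v.
  elim: j => [|j IH]; first by rewrite expr0 scale1r.
  rewrite iterS IH -[X in L X]addr0 L_linear operator0 addr0 Lv !scalerA -scalerBl.
  by congr (_ *: _); rewrite exprS; ring.
move: vk; rewrite vE => /eqP; rewrite scaler_eq0 expf_eq0 subr_eq0 (negbTE numu) andbF.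
by move/eqP.
Qed.

(** Induction on the list: a power of L - nu kills the component for nu and preserves
    the other generalized eigenspaces, on which it is injective. *)
Lemma gen_eigenspaces_free (s : seq K) (f : K -> V) : uniq s ->
  {in s, forall mu, subspace (E mu)} -> {in s, forall mu, E mu (f mu)} ->
  \sum_(mu <- s) f mu = 0 -> {in s, forall mu, f mu = 0}.
Proof.
elim: s f => [//|nu s IH] f /= /andP[nus us] sE fE.
rewrite big_cons => sum0.
have [Hnu [k fnu]] := fE nu (mem_head _ _).
have in_s mu : mu \in s -> mu \in nu :: s by rewrite in_cons => ->; rewrite orbT.
have itE j mu : mu \in s -> E mu (iter j (T nu) (f mu)).
  move=> mus; elim: j => [|j IHj]; first exact/fE/in_s.
  exact: gen_eigenspace_shift (sE _ (in_s _ mus)) IHj.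
have it_inj j mu : mu \in s -> iter j (T nu) (f mu) = 0 -> f mu = 0.
  move=> mus; elim: j => [//|j IHj] /= /gen_eigenspace_shift_inj.
  move=> /(_ mu) H0; apply: IHj; apply: H0; last exact: itE.
  by apply: contraNneq nus => ->.
have sum_it : \sum_(mu <- s) iter k (T nu) (f mu) = 0.
  have -> : \sum_(mu <- s) iter k (T nu) (f mu) = iter k (T nu) (\sum_(mu <- s) f mu).
    elim: (s) => [|mu s' IHs]; first by rewrite !big_nil iter_shifted0.
    by rewrite !big_cons IHs -[f mu in RHS]scale1r iter_shifted_linear scale1r.
  have := congr1 (iter k (T nu)) sum0; rewrite iter_shifted0.
  by rewrite -[f nu]scale1r iter_shifted_linear fnu scaler0 add0r.
have f0 : {in s, forall mu, f mu = 0}.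
  move=> mu mus; apply: (it_inj k mu mus).
  apply: (IH (fun mu => iter k (T nu) (f mu))) => // [|mu' mu's].
  - by move=> mu' /in_s; exact: sE.
  - exact: itE.
move=> mu; rewrite in_cons => /predU1P[->|]; last exact: f0.
by move: sum0; rewrite big_seq big1 ?addr0.
Qed.

Definition eigenspace_sum (s : seq K) : set V :=
  [set v | exists2 f : K -> V, {in s, forall mu, E mu (f mu)} & v = \sum_(mu <- s) f mu].

Lemma eigenspace_sum_dimension (s : seq K) (n : K -> nat) : uniq s ->
  {in s, forall mu, has_dimension (E mu) (n mu)} ->
  has_dimension (eigenspace_sum s) (\sum_(mu <- s) n mu).
Proof.
elim: s => [|nu s IH] /=.
  move=> _ _; rewrite big_nil; exists (fun=> 0); split=> [a _ []//|v].
  split=> [[f _ ->]|[a ->]]; first by exists (fun=> 0); rewrite big_nil big_ord0.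
  by exists (fun=> 0) => //; rewrite big_nil big_ord0.
move=> /andP[nus us] dE.
have in_s mu : mu \in s -> mu \in nu :: s by rewrite in_cons => ->; rewrite orbT.
have dnu := dE nu (mem_head _ _).
have {}IH := IH us (fun mu mus => dE mu (in_s mu mus)).
rewrite big_cons.
have sub : {in nu :: s, forall mu, subspace (E mu)}.
  by move=> mu /dE /has_dimension_subspace.
pose glue v (f : K -> V) mu := if mu == nu then v else f mu.
have glueE v f : \sum_(mu <- nu :: s) glue v f mu = v + \sum_(mu <- s) f mu.
  rewrite big_cons {1}/glue eqxx; congr (_ + _); rewrite big_seq [RHS]big_seq.
  by apply: eq_bigr => mu mus; rewrite /glue; case: eqP => // e; rewrite -e mus in nus.
have glueP v f : E nu v -> {in s, forall mu, E mu (f mu)} ->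
    {in nu :: s, forall mu, E mu (glue v f mu)}.
  move=> Ev Ef mu; rewrite in_cons /glue; case: eqP => [->//|_ /=]; exact: Ef.
rewrite (_ : eigenspace_sum _ = [set v | exists v1 v2,
   [/\ E nu v1, eigenspace_sum s v2 & v = v1 + v2]]).
  apply: has_dimension_add => // v w Ev [f Ef ->]; rewrite -glueE.
  move=> /(gen_eigenspaces_free (s := nu :: s)) H0.
  have {}H0 := H0 _ sub (glueP v f Ev Ef).
  rewrite /= nus us in H0; have {}H0 := H0 isT.
  split; first by have := H0 nu (mem_head _ _); rewrite /glue eqxx.
  rewrite big_seq big1// => mu mus; have := H0 mu (in_s mu mus); rewrite /glue.
  by case: eqP => // e; rewrite -e mus in nus.
apply/seteqP; split=> v /=.
  move=> [f Ef ->]; exists (f nu), (\sum_(mu <- s) f mu); split; last by rewrite big_cons.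
    exact/Ef/mem_head.
  by exists f => // mu /in_s; exact: Ef.
move=> [v1 [v2 [Ev1 [f Ef ->] ->]]]; exists (glue v1 f); first exact: glueP.
by rewrite glueE.
Qed.

(** If L v = nu v with nu outside s, then L - nu kills each component of v, and it is
    injective on each of the summands. *)
Lemma eigenspace_sum_matrix (s : seq K) (n : nat) (b : 'I_n -> V) : uniq s ->
  {in s, forall mu, subspace (E mu)} ->
  (forall a : 'I_n -> K, \sum_i a i *: b i = 0 -> forall i, a i = 0) ->
  (forall v, eigenspace_sum s v <-> exists a : 'I_n -> K, v = \sum_i a i *: b i) ->
  exists2 A : 'M[K]_n, forall i, L (b i) = \sum_j A i j *: b j &
    forall nu, eigenvalue A nu -> nu \in s.
Proof.
move=> us sE bfree bspan.
have bE i : eigenspace_sum s (b i).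
  apply/bspan; exists (fun j => (i == j)%:R).
  rewrite (bigD1 i)//= eqxx scale1r big1 ?addr0// => j ji.
  by rewrite eq_sym (negbTE ji) scale0r.
have L_sum (r : seq K) (f : K -> V) : L (\sum_(mu <- r) f mu) = \sum_(mu <- r) L (f mu).
  elim: r => [|mu r IH]; first by rewrite !big_nil operator0.
  by rewrite !big_cons -[f mu]scale1r L_linear IH !scale1r.
have L_ord (x : 'I_n -> K) : L (\sum_i x i *: b i) = \sum_i x i *: L (b i).
  elim/big_rec2: _ => [|i y1 y2 _ IH]; first exact: operator0.
  by rewrite L_linear IH.
have [i|a Ha] := @choice _ _ (fun i (x : 'I_n -> K) => L (b i) = \sum_j x j *: b j).
  apply/bspan; have [f Ef ->] := bE i.
  by exists (fun mu => L (f mu)) => // mu /Ef; exact: gen_eigenspace_stable.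
exists (\matrix_(i, j) a i j) => [i|nu /eigenvalueP[x xA x0]].
  by rewrite Ha; apply: eq_bigr => j _; rewrite mxE.
pose v := \sum_i x 0 i *: b i.
have Lv : L v = nu *: v.
  rewrite /v L_ord scaler_sumr.
  transitivity (\sum_j (x *m (\matrix_(i, j) a i j)) 0 j *: b j); last first.
    by rewrite xA; apply: eq_bigr => j _; rewrite mxE scalerA.
  under eq_bigr => i _ do rewrite Ha scaler_sumr.
  rewrite exchange_big; apply: eq_bigr => j _; rewrite mxE scaler_suml.
  by apply: eq_bigr => i _; rewrite mxE scalerA.
have [f Ef vf] : eigenspace_sum s v by apply/bspan; exists (fun i => x 0 i).
apply: contraT => nus; exfalso.
have f0 : {in s, forall mu, f mu = 0}.
  have T0 : {in s, forall mu, T nu (f mu) = 0}.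
    apply: gen_eigenspaces_free => //.
      by move=> mu mus; apply: gen_eigenspace_shift; [exact: sE|exact: Ef].
    by rewrite sumrB -scaler_sumr -L_sum -vf Lv subrr.
  move=> mu mus; apply: (@gen_eigenspace_shift_inj mu nu); [|exact: Ef|exact: T0].
  by apply: contraNneq nus => ->.
have v0 : v = 0 by rewrite vf big_seq big1.
move/eqP: x0; apply; apply/rowP => i; rewrite mxE.
exact: (bfree (fun i => x 0 i)).
Qed.

End GeneralizedEigenspaces.

(** * The complex exponential and the transfer operator *)

Section ComplexExponential.
Context {R : realType}.
Implicit Types (x y : R) (z w : CC R).

Lemma is_derive_expansion (f : R -> R) (a l : R) : is_derive a 1 f l ->
  forall e, 0 < e -> exists2 d, 0 < d &
    forall h, `|h| < d -> `|f (a + h) - f a - l * h| <= e * `|h|.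
Proof.
move=> [df dl] e e0.
have : (fun h => h^-1 *: (f (h *: 1 + a) - f a)) @ 0^' --> l.
  by rewrite -dl; exact: df.
move=> /cvgrPdist_lt /(_ _ e0) /nbhs_ballP[d /= d0 H]; exists d => // h hd.
have [->|h0] := eqVneq h 0.
  by rewrite addr0 subrr mulr0 subr0 normr0 mulr0.
have := H h; rewrite -ball_normE /ball_ /= sub0r normrN => /(_ hd h0) /ltW.
rewrite (_ : h *: 1 + a = a + h); last by rewrite addrC; congr (_ + _); exact: mulr1.
have nh : 0 < `|h| by rewrite normr_gt0.
rewrite -(ler_pM2r nh) -normrM mulrBl.
rewrite (_ : h^-1 *: (f (a + h) - f a) * h = f (a + h) - f a); last first.
  by rewrite [X in X * _]mulrC mulfVK.
by rewrite distrC.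
Qed.

Lemma cexpD z w : cexp (z + w) = cexp z * cexp w.
Proof.
case: z w => [a b] [c d]; rewrite /cexp /= expRD cosD sinD.
by apply/eqP; rewrite eq_complex /=; apply/andP; split; apply/eqP; ring.
Qed.

(** Real and imaginary part of exp(x + iy) - 1 - (x + iy) are
    (e^x - 1 - x) + e^x (cos y - 1) and e^x (sin y - y) + (e^x - 1) y. *)
Lemma cexp_expansion0 (e : R) : 0 < e -> exists2 d : R, 0 < d &
  forall h : CC R, normc h < d -> normc (cexp h - 1 - h) <= e * normc h.
Proof.
move=> e0.
(* The two parts are at most 4 e1 |h| and 5 e1 |h|. *)
pose e1 := Num.min (e / 10) 1.
have e10 : 0 < e1 by rewrite lt_min divr_gt0//=.
have e1e : e1 <= e / 10 by rewrite ge_min lexx.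
have e11 : e1 <= 1 by rewrite ge_min lexx orbT.
clearbody e1.
have [d1 d10 H1] := is_derive_expansion (is_derive_expR (0 : R)) e10.
have [d2 d20 H2] := is_derive_expansion (is_derive_sin (0 : R)) e10.
have [d3 d30 H3] := is_derive_expansion (is_derive_cos (0 : R)) e10.
exists (Num.min (Num.min d1 d2) (Num.min d3 e1)); first by rewrite !lt_min d10 d20 d30 e10.
case=> x y; set h := x +i* y; rewrite !lt_min => /andP[/andP[hd1 hd2] /andP[hd3 he1]].
have nx : `|x| <= normc h := normRe h.
have ny : `|y| <= normc h := normIm h.
have := H1 x (le_lt_trans nx hd1); have := H2 y (le_lt_trans ny hd2).
have := H3 y (le_lt_trans ny hd3).
rewrite !add0r expR0 sin0 cos0 !subr0 oppr0 mul0r !subr0 !mul1r => K3 K2 K1.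
have n0 := normc_ge0 h.
move: K1 K2 K3; set E := expR x; set S := sin y; set C := cos y => K1 K2 K3.
have x1 : `|x| <= e1 by exact: le_trans nx (ltW he1).
have Ex : `|E - 1| <= 2 * `|x|.
  rewrite -(subrK x (E - 1)); apply: le_trans (ler_normD _ _) _.
  apply: le_trans (lerD K1 (lexx _)) _.
  rewrite mulrDl mul1r lerD2r ler_piMl//.
have E3 : `|E| <= 3.
  rewrite -(subrK 1 E); apply: le_trans (ler_normD _ _) _; rewrite normr1.
  have xx : `|x| <= 1 by exact: le_trans x1 e11.
  by clear -xx Ex; lra.
have A1 : `|E * C - 1 - x| <= 4 * e1 * normc h.
  rewrite (_ : _ - _ = (E - 1 - x) + E * (C - 1)); last by ring.
  apply: le_trans (ler_normD _ _) _; rewrite normrM.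
  have P1 : `|E - 1 - x| <= e1 * normc h by apply: le_trans K1 _; rewrite ler_pM2l.
  have P2 : `|E| * `|C - 1| <= 3 * (e1 * normc h).
    by apply: ler_pM (normr_ge0 _) (normr_ge0 _) E3 _; apply: le_trans K3 _; rewrite ler_pM2l.
  by clear -P1 P2; lra.
have A2 : `|E * S - y| <= 5 * e1 * normc h.
  rewrite (_ : _ - _ = E * (S - y) + (E - 1) * y); last by ring.
  apply: le_trans (ler_normD _ _) _; rewrite !normrM.
  have P1 : `|E| * `|S - y| <= 3 * (e1 * normc h).
    by apply: ler_pM (normr_ge0 _) (normr_ge0 _) E3 _; apply: le_trans K2 _; rewrite ler_pM2l.
  have P2 : `|E - 1| * `|y| <= (2 * e1) * normc h.
    by apply: ler_pM (normr_ge0 _) (normr_ge0 _) _ ny; apply: le_trans Ex _; rewrite ler_pM2l.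
  by clear -P1 P2; lra.
apply: le_trans (normc_leD _) _.
rewrite /cexp /= -/E -/S -/C !mul0r subr0 addr0 oppr0 addr0.
apply: le_trans (lerD A1 A2) _.
rewrite -mulrDl; apply: ler_wpM2r => //.
by clear -e1e e10; lra.
Qed.

Lemma derivable_cexp z : derivable (cexp : CC R -> CC R) z 1.
Proof.
apply: (@expansion_derivable _ _ _ (cexp z)) => e e0.
have k0 : 0 < normc (cexp z) + 1 by rewrite ltr_wpDl// normc_ge0.
have [d d0 H] := cexp_expansion0 (divr_gt0 e0 k0).
exists d => // w wz; have := H _ wz; move: wz.
set h := w - z; have -> : w = z + h by rewrite /h addrC subrK.
move=> _ Hh; rewrite cexpD.
rewrite (_ : _ - _ = cexp z * (cexp h - 1 - h)); last first.
  by rewrite !mulrBr mulr1.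
rewrite normcM; apply: le_trans (ler_wpM2l (normc_ge0 _) Hh) _.
rewrite mulrA; apply: ler_wpM2r; first exact: normc_ge0.
rewrite mulrCA ler_piMr ?(ltW e0)// ler_pdivrMr// mul1r lerDl//.
Qed.

End ComplexExponential.

Section Transfer.
Context {R : realType} (Omega : set (CC R)) (d : nat) (gam : 'I_d -> CC R -> CC R)
  (G : CC R -> CC R).
Hypothesis Omega_open : open Omega.
Hypothesis gam_holo : forall j, holomorphic_on Omega (gam j).
Hypothesis G_holo : holomorphic_on Omega G.
Hypothesis gam_in : forall j z, Omega z -> Omega (gam j z).

Lemma transfer_linear N (U : 'I_d -> 'M[R[i]]_N) a F F' :
  transfer Omega gam G U (a *: F + F') =
  a *: transfer Omega gam G U F + transfer Omega gam G U F'.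
Proof.
apply/funext => z; rewrite [RHS]/GRing.add /= /transfer.
rewrite [X in _ = X + _](_ : _ = a *: transfer Omega gam G U F z)// /transfer.
case: ifP => _; last by rewrite scaler0 addr0.
rewrite scaler_sumr -big_split; apply: eq_bigr => j _ /=.
rewrite (_ : (a *: F + F') (gam j z) = a *: F (gam j z) + F' (gam j z))//.
by rewrite mulmxDr -scalemxAr scalerDr !scalerA mulrC.
Qed.

(** A permutation matrix acts on a column by permuting its entries. *)
Lemma transferE N (U : 'I_d -> 'M[R[i]]_N) (s : 'I_d -> {perm 'I_N}) F z a :
  (forall j, U j = perm_mx (s j)) -> Omega z ->
  transfer Omega gam G U F z a ord0 =
  \sum_j cexp (G (gam j z)) * F (gam j z) (s j a) ord0.
Proof.
move=> Us Oz; rewrite /transfer mem_set// summxE; apply: eq_bigr => j _.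
by rewrite [LHS]mxE Us -row_permE mxE.
Qed.

Lemma transfer_holomorphic N (U : 'I_d -> 'M[R[i]]_N) (s : 'I_d -> {perm 'I_N}) F :
  (forall j, U j = perm_mx (s j)) -> holomorphic_vec Omega F ->
  holomorphic_vec Omega (transfer Omega gam G U F).
Proof.
move=> Us hF a z Oz.
pose T j (z : CC R) : CC R := cexp (G (gam j z)) * coord F (s j a) (gam j z).
apply: (@near_eq_derivable _ _ _ (\sum_j T j : CC R -> CC R)).
  have : nbhs z Omega by apply: open_nbhs_nbhs; split.
  by apply: filterS => w Ow; rewrite /coord (transferE _ _ Us Ow) fct_sumE.
apply: derivable_sum => j; apply: derivableCM.
  apply: (@derivableC_comp R (fun z => G (gam j z)) cexp); last exact: derivable_cexp.
  apply: (@derivableC_comp R (gam j) G); first exact: gam_holo.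
  by apply/G_holo/gam_in.
apply: (@derivableC_comp R (gam j) (coord F (s j a))); first exact: gam_holo.
by apply/hF/gam_in.
Qed.

End Transfer.

Section BoundedIntegral.
Context {R : realType}.

(** The integral of a nonnegative function is a supremum over the simple functions
    below it, hence monotone in the function, measurable or not. *)
Lemma integral_bounded_lty (A : set (R * R)) (f : R * R -> \bar R) (B M : R) :
  (forall p, A p -> `|p.1| <= B /\ `|p.2| <= B) ->
  (forall p, A p -> (0 <= f p <= M%:E)%E) ->
  (\int[lebesgue_measure \x lebesgue_measure]_(p in A) f p < +oo)%E.
Proof.
move=> AB fM.
pose Q : set (R * R) := `[- B, B] `*` `[- B, B].
have mQ : measurable Q by exact: measurableX.
have M0 p : A p -> 0 <= M by move=> /fM /andP[f0 fm]; rewrite -lee_fin (le_trans f0).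
pose M' := Num.max M 0.
have M'0 : 0 <= M' by rewrite le_max lexx orbT.
have MM' : M <= M' by rewrite le_max lexx.
apply: (@le_lt_trans _ _ (\int[lebesgue_measure \x lebesgue_measure]_(p in Q) (cst M'%:E p))%E).
  rewrite ge0_integralE => [|p /fM /andP[]//].
  rewrite [leRHS]ge0_integralE => [|p _]; last by rewrite lee_fin.
  apply: ereal_sup_le => _ [h hf <-]; exists h => // p.
  apply: le_trans (hf p) _; rewrite /patch.
  case: ifPn => [/set_mem Ap|_]; last by case: ifPn => _; rewrite ?lee_fin.
  rewrite mem_set; last first.
    have [h1 h2] := AB _ Ap.
    by split; rewrite /= in_itv/= -ler_norml.
  have /andP[_ fm] := fM _ Ap; apply: le_trans fm _; by rewrite lee_fin.
rewrite integral_cst//.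
rewrite [X in (_ * X)%E](_ : _ = lebesgue_measure (`[(- B)%R, B]%classic : set R) *
   lebesgue_measure (`[(- B)%R, B]%classic : set R))%E; last first.
  exact: product_measure1E.
rewrite lebesgue_measure_itv.
by case: ifP => _ //=; rewrite ?mule0 ?mul0e ?mule0 ?ltry// -!EFinD -!EFinM ltry.
Qed.

End BoundedIntegral.

(** * Counting eigenvalues *)

Section Counting.

Lemma card_seq (T : choiceType) (s : seq T) : uniq s ->
  ([set` s] #= `I_(size s))%card.
Proof.
move=> us; rewrite (_ : [set` s] = [set` finmap.seq_fset tt s]).
  by apply/card_eq_fsetP; rewrite finmap.size_seq_fset undup_id.
have E x : (x \in finmap.seq_fset tt s) = (x \in s) by exact: finmap.seq_fsetE.
by apply/seteqP; split=> x xs; [exact: (etrans (E x) xs)|exact: (etrans (esym (E x)) xs)].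
Qed.

Lemma sum_count_undup (T : eqType) (s : seq T) :
  (\sum_(x <- undup s) count_mem x s)%N = size s.
Proof.
rewrite -[RHS]sum1_size -(big_undup_iterop_count addn s predT (fun=> 1%N)).
apply: eq_bigr => x _; case: (count_mem x s) => // n.
by rewrite iteropS iter_addn mul1n addn1.
Qed.

Context {R : realType}.

Lemma large_terms (lam : nat -> CC R) (e : R) : 0 < e -> lam @ \oo --> (0 : CC R) ->
  exists2 js : seq nat, uniq js & forall j, (j \in js) = (e <= normc (lam j)).
Proof.
move=> e0 /cvgCP /(_ e e0) [m _ Hm].
exists [seq j <- iota 0 m | e <= normc (lam j)]; first by rewrite filter_uniq ?iota_uniq.
move=> j; rewrite mem_filter mem_iota add0n /= andb_idr// => ej.
rewrite ltnNge; apply/negP => /Hm /=; rewrite subr0 => /(le_lt_trans ej).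
by rewrite ltxx.
Qed.

(** The terms of modulus at least e have finitely many distinct values, each nonzero
    and repeated as often as the dimension of its generalized eigenspace.  So
    their number n is the dimension of the sum of these eigenspaces, in which b is
    a basis and A the matrix of L. *)
Lemma spectral_count (V : lmodType R[i]) (H : set V) (L : V -> V) (lam : nat -> CC R) (e : R) :
  (forall a v w, L (a *: v + w) = a *: L v + L w) -> (forall v, H v -> H (L v)) ->
  eigenvalue_sequence H L lam -> 0 < e ->
  exists (n : nat) (s : seq R[i]) (b : 'I_n -> V) (A : 'M[R[i]]_n),
    ([set j | e <= normc (lam j)] #= `I_n)%card /\
    [/\ forall a : 'I_n -> R[i], \sum_i a i *: b i = 0 -> forall i, a i = 0,
        forall i, exists2 f : R[i] -> V, {in s, forall mu, H (f mu)} &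
          b i = \sum_(mu <- s) f mu,
        forall i, L (b i) = \sum_j A i j *: b j &
        forall nu, eigenvalue A nu -> e <= normc nu].
Proof.
move=> Llin Lst [lam0 lamdim] e0.
have [js ujs jsE] := large_terms e0 lam0.
pose s : seq R[i] := undup [seq lam j | j <- js].
have sP mu : mu \in s -> e <= normc mu.
  by rewrite mem_undup => /mapP[j]; rewrite jsE => ej ->.
pose n (mu : R[i]) : nat := count_mem mu [seq lam j | j <- js].
have dimE : {in s, forall mu, has_dimension (gen_eigenspace H L mu) (n mu)}.
  move=> mu /sP mue.
  have mu0 : mu != 0 by apply: contraTneq mue => ->; rewrite normc0 -ltNge.
  have [k [dk ck]] := lamdim mu mu0.
  suff -> : n mu = k by [].
  apply/card_eq_II; apply: card_eq_trans ck.
  rewrite (_ : [set j | lam j = mu] = [set` [seq j <- js | lam j == mu]]).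
    rewrite /n count_map card_eq_sym -size_filter.
    by apply: card_seq; rewrite filter_uniq.
  apply/seteqP; split=> j /=; rewrite mem_filter.
    by move=> lj; rewrite lj eqxx jsE lj.
  by move=> /andP[/eqP].
have us : uniq s by exact: undup_uniq.
have [b [bfree bspan]] := eigenspace_sum_dimension Llin Lst us dimE.
have sz : (\sum_(mu <- s) n mu)%N = size js by rewrite sum_count_undup size_map.
have [|A LA EA] := eigenspace_sum_matrix Llin Lst us _ bfree bspan.
  by move=> mu /dimE /has_dimension_subspace.
exists (\sum_(mu <- s) n mu)%N, s, b, A; split.
  rewrite sz (_ : [set j | _] = [set` js]); first exact: card_seq.
  by apply/seteqP; split => j /=; rewrite jsE.
split=> // [i|nu /EA /sP//].
have [f Ef bf] : eigenspace_sum H L s (b i).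
  apply/bspan; exists (fun j => (i == j)%:R).
  rewrite (bigD1 i)//= eqxx scale1r big1 ?addr0// => j ji.
  by rewrite eq_sym (negbTE ji) scale0r.
by exists f => // mu /Ef [].
Qed.

Lemma compact_bounded_above (K : set (CC R)) (f : CC R -> R) : compact K ->
  (forall z, K z -> {for z, continuous f}) -> exists M : R, forall z, K z -> f z <= M.
Proof.
move=> cK cf.
have cf' : {within K, continuous f}.
  by apply: continuous_in_subspaceT => z; rewrite inE; exact: cf.
have [M [Mr HM]] := compact_bounded (continuous_compact cf' cK).
exists (M + 1) => z Kz.
have /HM : M < M + 1 by rewrite ltrDl.
by move=> /(_ (f z)) H; apply: le_trans (ler_norm _) (H _); exists z.
Qed.

End Counting.

Section TransferBound.
Context {R : realType} (Omega : set (CC R)) (d : nat) (gam : 'I_d -> CC R -> CC R)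
  (G : CC R -> CC R).
Hypothesis Omega_open : open Omega.
Hypothesis Omega_bounded : bounded_set Omega.
Hypothesis gam_holo : forall j, holomorphic_on Omega (gam j).
Hypothesis gam_sub : forall j, closure (gam j @` Omega) `<=` Omega.
Hypothesis G_holo : holomorphic_on Omega G.

Definition image_closure : set (CC R) := \big[setU/set0]_(j < d) closure (gam j @` Omega).

Lemma image_closureP z : image_closure z <-> exists j, closure (gam j @` Omega) z.
Proof.
rewrite /image_closure; split.
  by elim/big_ind: _ => // [A B HA HB [/HA|/HB]//|j _ zj]; exists j.
by move=> [j zj]; rewrite (bigD1 j)//=; left.
Qed.

Lemma image_closure_sub : image_closure `<=` Omega.
Proof. by move=> z /image_closureP[j]; exact: gam_sub. Qed.

Lemma gam_image_closure j z : Omega z -> image_closure (gam j z).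
Proof.
move=> Oz; apply/image_closureP; exists j; apply: subset_closure.
by exists z.
Qed.

Lemma gam_in j z : Omega z -> Omega (gam j z).
Proof. by move=> /(gam_image_closure j) /image_closure_sub. Qed.

Lemma compact_image_closure : compact image_closure.
Proof.
have [B HB] := bounded_normc Omega_bounded.
apply: bigsetU_compact => j _; apply: (closed_bounded_compact (B := B)).
  exact: closed_closure.
by move=> z /gam_sub /HB.
Qed.

(** On Omega the image of F is bounded by a supremum over the compact set of the
    images, and a bounded function on a bounded set is square integrable. *)
Lemma bergman_stable N (U : 'I_d -> 'M[R[i]]_N) (s : 'I_d -> {perm 'I_N}) F :
  (forall j, U j = perm_mx (s j)) -> bergman Omega F ->
  bergman Omega (transfer Omega gam G U F).
Proof.
move=> Us [F0 hF _]; have hF' : holomorphic_vec Omega F by exact: hF.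
have hT : holomorphic_vec Omega (transfer Omega gam G U F).
  exact: (transfer_holomorphic Omega_open gam_holo G_holo gam_in Us hF').
split; [|exact: hT|].
  move=> z nz; rewrite /transfer memNset//.
  by apply/funext => i; apply/funext => j; rewrite mxE.
have [B HB] := bounded_normc Omega_bounded.
have [M HM] : exists M : R, forall z, image_closure z -> forall j i,
    normc (cexp (G z) * F z (s j i) ord0) <= M.
  have H j i : exists M : R, forall z, image_closure z ->
      normc (cexp (G z) * F z (s j i) ord0) <= M.
    apply: compact_bounded_above compact_image_closure _ => z /image_closure_sub Oz.
    apply: (@continuous_comp _ _ _ (fun z => cexp (G z) * coord F (s j i) z : CC R)).
      apply: continuousCM; apply: derivable_continuousC; last exact: hF.
      apply: (@derivableC_comp R G cexp); first exact: G_holo.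
      exact: derivable_cexp.
    exact: continuous_normc.
  have [M HM] := choice (fun p : 'I_d * 'I_N => H p.1 p.2).
  exists (\sum_p `|M p|) => z Kz j i; apply: le_trans (HM (j, i) z Kz) _.
  apply: le_trans (ler_norm _) _; rewrite (bigD1 (j, i))//= lerDl.
  by apply: sumr_ge0.
apply: (@integral_bounded_lty _ _ _ B (\sum_(i < N) (d%:R * M) ^+ 2)).
  move=> [x y] /= /HB; move: (normRe (x +i* y)) (normIm (x +i* y)) => /= h1 h2 h3.
  by split; [exact: le_trans h1 h3|exact: le_trans h2 h3].
move=> [x y] /= Oz; rewrite !lee_fin; apply/andP; split.
  by apply: sumr_ge0 => i _; exact: sqr_ge0.
apply: ler_sum => i _; set z := x +i* y in Oz *.
have le1 : normc (transfer Omega gam G U F z i ord0) <= d%:R * M.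
  rewrite (@transferE _ _ _ _ G _ _ _ F _ i Us Oz) -lecR.
  rewrite -normc_normE; apply: le_trans (ler_norm_sum _ _ _) _.
  rewrite rmorphM rmorph_nat mulr_natl -[X in _ *+ X]card_ord -sumr_const.
  by apply: ler_sum => j _; rewrite normc_normE lecR; apply: HM; exact: gam_image_closure.
by rewrite ler_sqr ?nnegrE ?normc_ge0// (le_trans (normc_ge0 _) le1).
Qed.

(** Up to the 1 that keeps it positive, the constant is 25 (from the evaluation
    bounds) times the sum of the total masses of the two functionals, the outer
    one multiplied by d^2 B^2 where B bounds the weights exp(G) on the images. *)
Theorem transfer_eigenvalue_bound : exists2 C : R, 0 < C &
  forall N (U : 'I_d -> 'M[R[i]]_N) (lam : nat -> CC R) (e : R),
    (forall j, is_perm_mx (U j)) ->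
    eigenvalue_sequence (bergman Omega (N := N)) (transfer Omega gam G U) lam ->
    0 < e -> exists n : nat, ([set j | e <= normc (lam j)] #= `I_n)%card /\
      e * n%:R <= C * N%:R.
Proof.
have [sq [sqD sqK]] := bounding_squares compact_image_closure Omega_open image_closure_sub.
have ev1 := inner_evaluation sqD sqK.
have ev2 := outer_evaluation sqD.
set J1 := inner_functional sqD in ev1; set J2 := outer_functional sqD in ev2.
have [B HB] : exists B : R, forall z, image_closure z -> normc (cexp (G z)) <= B.
  apply: compact_bounded_above compact_image_closure _ => z /image_closure_sub Oz.
  apply: (@continuous_comp _ _ _ (fun z => cexp (G z) : CC R)); last exact: continuous_normc.
  apply: derivable_continuousC; apply: (@derivableC_comp R G cexp); first exact: G_holo.
  exact: derivable_cexp.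
pose B' := Num.max B 0.
have B'0 : 0 <= B' by rewrite le_max lexx orbT.
pose mass : R[i] := 25 * (J1 (fun=> 1) + d%:R ^+ 2 * B'%:C ^+ 2 * J2 (fun=> 1)).
have mass0 : 0 <= mass.
  apply: mulr_ge0 => //; apply: addr_ge0.
    by apply: pf_ge0; [exact: cont_in_cst|move=> z _].
  apply: mulr_ge0; first by rewrite mulr_ge0 ?exprn_ge0 ?ler0n// lecR.
  by apply: pf_ge0; [exact: cont_in_cst|move=> z _].
have Rm0 : 0 <= Re mass by move: mass0; rewrite lecE => /andP[].
exists (Re mass + 1); first by rewrite ltr_wpDl.
move=> N U lam e Uperm lamE e0.
have [s Us] := choice (fun j => is_perm_mxP _ (Uperm j)).
have Tst F : bergman Omega F -> bergman Omega (transfer Omega gam G U F).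
  exact: bergman_stable.
have [n [mus [b [A [card_n [bfree bH bA Aeig]]]]]] :=
  spectral_count (@transfer_linear _ _ _ gam G N U) Tst lamE e0.
exists n; split => //.
have hb i : holomorphic_vec Omega (b i).
  have [f Hf ->] := bH i; move=> a z Oz.
  rewrite (_ : coord _ a = \sum_(mu <- mus) (fun w => coord (f mu) a w)); last first.
    by apply/funext => w; rewrite /coord !fct_sumE summxE.
  rewrite big_seq; elim/big_rec: _ => [|mu g mumus dg]; first exact: derivable_cst.
  apply: (@derivableCD R (coord (f mu) a) g); last exact: dg.
  by have [_ hfm _] := Hf mu mumus; exact: hfm.
have b0 i z : ~ Omega z -> b i z = 0.
  move=> nz; have [f Hf ->] := bH i; rewrite fct_sumE big_seq big1// => mu mumus.
  have [/(_ z nz) fz _ _] := Hf mu mumus.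
  by apply/matrixP => k l; rewrite [RHS]mxE; have := congr1 (fun g => g k l) fz.
have := @eigenvalue_bound R N Omega image_closure _ _ J1 J2 25 B'%:C d
  (fun l z => cexp (G (gam l z))) gam (fun l => s l) n b A e%:C.
move=> /(_ _ _ _ (squares_sub sqD) (doubled_squares_sub sqD) ev1 ev2 gam_image_closure).
move=> /(_ _ _ _ _ hb b0) H.
have {}H : e%:C * n%:R *+ 2 <= N%:R * 25 * (J1 (fun=> 1) + d%:R ^+ 2 * B'%:C ^+ 2 * J2 (fun=> 1)).
  apply: H => //.
  - by rewrite lecR.
  - by rewrite ltcR.
  - move=> l z Oz; rewrite normc_normE lecR le_max HB//; exact: gam_image_closure.
  - move=> u u0; apply/rowP => i; rewrite mxE.
    exact: (bfree (fun i => u 0 i)).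
  - move=> i z a Oz; rewrite /lincomb.
    under eq_bigr => j _ do rewrite mxE.
    by rewrite -bA (@transferE _ _ _ _ G _ _ _ (b i) _ a Us Oz).
  - by move=> a /Aeig; rewrite normc_normE lecR.
rewrite -mulrA -/mass -(RRe_real (ger0_real mass0)) in H.
have : (e * n%:R *+ 2)%:C <= (N%:R * Re mass)%:C :> R[i].
  by rewrite rmorphMn !rmorphM !rmorph_nat.
rewrite lecR => H2.
have en0 : 0 <= e * n%:R by rewrite mulr_ge0// ltW.
have N0 : 0 <= N%:R :> R by [].
move: H2; rewrite mulr2n; set x := e * _; set y := Re mass in Rm0 *; set k := N%:R in N0 *.
move: en0; rewrite -/x; clear -Rm0 N0 => x0 H2.
nra.
Qed.

End TransferBound.

Theorem theorem1p1 (R : realType) (Omega : set (CC R)) (d : nat)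
    (gam : 'I_d -> CC R -> CC R) (G : CC R -> CC R)
    (Omega_open : open Omega) (Omega_bounded : bounded_set Omega)
    (Omega_sc : simply_connected Omega) (Omega_C2 : C2_boundary Omega)
    (d_ge2 : (2 <= d)%N)
    (gam_holo : forall j, holomorphic_on Omega (gam j))
    (gam_cont : forall j, extends_continuously Omega (gam j))
    (gam_sub : forall j, closure (gam j @` Omega) `<=` Omega)
    (G_holo : holomorphic_on Omega G)
    (G_cont : extends_continuously Omega G) :
  exists C0 : R, 0 < C0 /\
    forall (N : nat) (U : 'I_d -> 'M[R[i]]_N) (lam : nat -> CC R) (r : R),
      (1 <= N)%N -> (forall j, is_perm_mx (U j)) ->
      eigenvalue_sequence (bergman Omega (N := N)) (transfer Omega gam G U) lam ->
      0 < r ->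
      exists n : nat, ([set j | r^-1 <= normc (lam j)] #= `I_n)%card /\
        n%:R <= C0 * r * N%:R.
Proof.
have [C C0 H] := transfer_eigenvalue_bound Omega_open Omega_bounded gam_holo gam_sub G_holo.
exists C; split => // N U lam r _ Uperm lamE r0.
have ri0 : 0 < r^-1 by rewrite invr_gt0.
have [n [cn le_n]] := H N U lam _ Uperm lamE ri0; exists n; split => //.
by move: le_n; rewrite mulrC ler_pdivrMr// mulrAC.
Qed.
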